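(* For any recursive (decidable) sets of integers $\sigma,\rho\subseteq\mathbb N$, the parameterized problem $(\sigma,\rho)$-\textsc{Dominating Set of Size at Most} $k$ belongs to $\mathrm{W}[2]$.
   Context: Graphs are finite, simple and undirected; $N(v)$ denotes the (open) neighbourhood of a vertex $v$. For sets $\sigma,\rho\subseteq\mathbb N$, a set $D$ of vertices of a graph $G$ is $(\sigma,\rho)$-dominating if for every $v\in D$, $|N(v)\cap D|\in\sigma$, and for every $v\notin D$, $|N(v)\cap D|\in\rho$. $(\sigma,\rho)$-\textsc{Dominating Set of Size at Most} $k$ (for fixed $\sigma,\rho$): Input: a graph $G=(V,E)$ and an integer $k$. Parameter: $k$. Question: is there a $(\sigma,\rho)$-dominating set $D\subseteq V$ with $|D|\le k$? *)

(* Defs.v *)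
From mathcomp Require Import all_boot.

Set Implicit Arguments.
Unset Strict Implicit.
Unset Printing Implicit Defensive.

(* Random access machines after Cook and Reckhow.
    Registers [X_0, X_1, ...] hold natural numbers and are initially 0; there
    is a read-only input tape and a write-only output tape of numbers.  Every
    instruction has unit cost.  As there is no multiplication, numbers have
    length linear in the running time (plus that of the numbers read), so time
    is polynomially related to Turing machine time. *)

Inductive instr :=
| Const of nat & nat        (* X_i <- c *)
| Add of nat & nat & nat    (* X_i <- X_j + X_l *)
| Sub of nat & nat & nat    (* X_i <- X_j - X_l, truncated at 0 *)
| Fetch of nat & nat        (* X_i <- X_(X_j) *)
| Store of nat & nat        (* X_(X_i) <- X_j *)
| Jump of nat & nat         (* if X_j > 0, go to instruction number l *)
| Read of nat               (* X_i <- next input, 0 if the input is exhausted *)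
| Write of nat.             (* append X_i to the output *)

Definition program := seq instr.

Record config := Config {
  pc : nat;
  reg : nat -> nat;
  input : seq nat;
  output : seq nat }.

Definition upd (X : nat -> nat) (i v : nat) : nat -> nat :=
  fun j => if j == i then v else X j.

Definition exec (i : instr) (s : config) : config :=
  let: Config q X inp out := s in
  match i with
  | Const i c => Config q.+1 (upd X i c) inp out
  | Add i j l => Config q.+1 (upd X i (X j + X l)) inp out
  | Sub i j l => Config q.+1 (upd X i (X j - X l)) inp out
  | Fetch i j => Config q.+1 (upd X i (X (X j))) inp out
  | Store i j => Config q.+1 (upd X (X i) (X j)) inp out
  | Jump j l => Config (if 0 < X j then l else q.+1) X inp out
  | Read i => Config q.+1 (upd X i (head 0 inp)) (behead inp) out
  | Write i => Config q.+1 X inp (rcons out (X i))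
  end.

Definition halted (p : program) (s : config) : bool := size p <= pc s.

Definition step (p : program) (s : config) : config :=
  if halted p s then s else exec (nth (Const 0 0) p (pc s)) s.

Definition run (p : program) (x : seq nat) (T : nat) : config :=
  iter T (step p) (Config 0 (fun=> 0) x [::]).

(* [p] halts on input [x] after at most [T] steps, with output [y] *)
Definition outputs_in (p : program) (x y : seq nat) (T : nat) : Prop :=
  halted p (run p x T) /\ output (run p x T) = y.

Definition computable (f : nat -> nat) : Prop :=
  exists p : program, forall n, exists T, outputs_in p [:: n] [:: f n] T.

Definition recursive_set (A : {pred nat}) : Prop :=
  computable (fun n => nat_of_bool (n \in A)).

Definition param_problem := seq bool -> nat -> Prop.

(* The parameter comes first; the letters of the word are written as 1 and 2,
   so that a machine recognizes the end of the tape by reading 0. *)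
Definition instance_tape (w : seq bool) (k : nat) : seq nat :=
  k :: [seq (nat_of_bool b).+1 | b <- w].

Definition fpt_reducible (P Q : param_problem) : Prop :=
  exists (p : program) (f g : nat -> nat) (c : nat),
    [/\ computable f, computable g &
     forall (w : seq bool) (k : nat), exists (w' : seq bool) (k' T : nat),
       [/\ outputs_in p (instance_tape w k) (instance_tape w' k') T,
           T <= f k * (size w).+1 ^ c,
           k' <= g k &
           P w k <-> Q w' k']].

(* The nodes are numbered so that nodes [0, ..., ninputs - 1] are the input
   variables and node [ninputs + j] is the [j]-th gate. *)

Inductive gate :=
| Not of nat
| And of seq nat
| Or of seq nat.

Definition preds (g : gate) : seq nat :=
  match g with Not i => [:: i] | And s => s | Or s => s end.

Record circuit := Circuit {
  ninputs : nat;
  gates : seq gate;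
  out_node : nat }.

(* Every gate only refers to earlier nodes, whence acyclicity. *)
Definition wf_circuit (C : circuit) : bool :=
  (out_node C < ninputs C + size (gates C)) &&
  all (fun j => all (fun i => i < ninputs C + j)
                    (preds (nth (And [::]) (gates C) j)))
      (iota 0 (size (gates C))).

(* The values at all nodes, given those at the inputs, when the value at a gate
   is obtained by [F] from the sequence of values at the earlier nodes. *)
Definition node_values (T : Type) (F : seq T -> gate -> T)
    (inp : seq T) (gs : seq gate) : seq T :=
  foldl (fun vs g => rcons vs (F vs g)) inp gs.

Definition gate_eval (vs : seq bool) (g : gate) : bool :=
  match g with
  | Not i => ~~ nth false vs i
  | And s => all (nth false vs) s
  | Or s => has (nth false vs) s
  end.

Definition circuit_eval (C : circuit) (a : seq bool) : bool :=
  nth false (node_values gate_eval a (gates C)) (out_node C).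

(* maximum, over the paths ending in the output node, of the sum of the weights
   [wt g] of the gates on the path *)
Definition max_path (wt : gate -> nat) (C : circuit) : nat :=
  nth 0 (node_values (fun vs g => wt g + \max_(i <- preds g) nth 0 vs i)
           (nseq (ninputs C) 0) (gates C)) (out_node C).

Definition depth (C : circuit) : nat := max_path (fun=> 1) C.

Definition large (g : gate) : bool := 2 < size (preds g).

Definition weft (C : circuit) : nat := max_path (fun g => large g) C.

Definition nat_code (n : nat) : seq bool := nseq n true ++ [:: false].

Definition seq_code (T : Type) (c : T -> seq bool) (s : seq T) : seq bool :=
  flatten [seq true :: c x | x <- s] ++ [:: false].

Definition gate_code (g : gate) : seq bool :=
  match g with
  | Not i => nat_code 0 ++ nat_code i
  | And s => nat_code 1 ++ seq_code nat_code s
  | Or s => nat_code 2 ++ seq_code nat_code s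
  end.

Definition circuit_code (C : circuit) : seq bool :=
  nat_code (ninputs C) ++ seq_code gate_code (gates C) ++
  nat_code (out_node C).

Definition prefix_inj (T : Type) (c : T -> seq bool) : Prop :=
  forall x y s t, c x ++ s = c y ++ t -> x = y /\ s = t.

Lemma nat_code_inj : prefix_inj nat_code.
Proof.
elim=> [|n IH] [|m] s t //=; first by case.
by case=> /IH[<- <-].
Qed.

Lemma seq_code_inj (T : Type) (c : T -> seq bool) :
  prefix_inj c -> prefix_inj (seq_code c).
Proof.
move=> ci.
have consE x xs s :
    seq_code c (x :: xs) ++ s = true :: c x ++ (seq_code c xs ++ s).
  by rewrite /seq_code /= -!catA.
elim=> [|x xs IH] [|y ys] s t; rewrite ?consE //; first by case.
by case=> /ci[<-] /IH[<- <-].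
Qed.

Lemma gate_code_inj : prefix_inj gate_code.
Proof.
have si := seq_code_inj nat_code_inj.
by case=> [i|xs|xs] [j|ys|ys] s t //= [];
  [move/nat_code_inj | move/si | move/si] => -[<- <-].
Qed.

Lemma circuit_code_inj : injective circuit_code.
Proof.
move=> [n gs o] [n' gs' o']; rewrite /circuit_code /=.
case/nat_code_inj=> <- /(seq_code_inj gate_code_inj)[<-].
by move/(congr1 (cat^~ [::]))/nat_code_inj=> [<-].
Qed.

Definition weighted_circuit_sat (t h : nat) : param_problem := fun w k =>
  exists C : circuit,
    [/\ w = circuit_code C, wf_circuit C, weft C <= t, depth C <= h &
        exists a : (ninputs C).-tuple bool,
          count id a = k /\ circuit_eval C a].

(* The depth bound may depend on the problem, not on the instance. *)
Definition W (t : nat) (P : param_problem) : Prop :=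
  exists h : nat, fpt_reducible P (weighted_circuit_sat t h).

Definition nbhd (T : finType) (e : rel T) (v : T) : {set T} := [set u | e v u].

Definition sigma_rho_dominating (sigma rho : {pred nat})
    (T : finType) (e : rel T) (D : {set T}) : Prop :=
  (forall v, v \in D -> #|nbhd e v :&: D| \in sigma) /\
  (forall v, v \notin D -> #|nbhd e v :&: D| \in rho).

(* adjacency matrix, row by row *)
Definition graph_code (n : nat) (e : rel 'I_n) : seq bool :=
  [seq e u v | u <- enum 'I_n, v <- enum 'I_n].

Lemma size_graph_code n (e : rel 'I_n) : size (graph_code e) = n * n.
Proof. by rewrite size_allpairs size_enum_ord. Qed.

(* With [size_graph_code], a word encodes at most one graph. *)
Lemma graph_code_inj n (e e' : rel 'I_n) :
  graph_code e = graph_code e' -> e =2 e'.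
Proof.
move=> ee' u v; pose rows (e0 : rel 'I_n) s := [seq e0 x y | x <- s, y <- enum 'I_n].
suff gen s : u \in s -> rows e s = rows e' s -> e u v = e' u v.
  by apply: gen ee'; rewrite mem_enum.
elim: s => // x s IH; rewrite in_cons /rows !allpairs_cons => us /eqP.
rewrite eqseq_cat ?size_map // => /andP[/eqP/eq_in_map xE /eqP ss].
by case/orP: us => [/eqP-> | us]; [apply: xE; rewrite mem_enum | apply: IH].
Qed.

Definition dominating_set_at_most (sigma rho : {pred nat}) : param_problem :=
  fun w k => exists (n : nat) (e : rel 'I_n),
    [/\ symmetric e, irreflexive e, w = graph_code e &
        exists D : {set 'I_n}, sigma_rho_dominating sigma rho e D /\ #|D| <= k].

(* Main.v *)
Require Import Defs.
From mathcomp Require Import all_boot.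
From mathcomp Require Import zify.

(** Number the at most [k] chosen vertices: a Boolean variable [x_(i,u)], for
    [i < k] and [u <= n], says that the [i]-th chosen vertex is [u], where
    [u = n] means that there is none.  Relative to a vertex [v], every slot [u]
    has a type: 2 if [u = v], 1 if [u] is a neighbour of [v], 0 otherwise; and
    whether [v] is properly dominated depends only on the sequence of the types
    of the [k] chosen slots.  So for every [v] and every one of the [3 ^ k]
    patterns [c] that are not allowed we state that some [i]-th chosen slot has
    a type other than [c_i]: this is the disjunction of the [x_(i,u)] over all
    [i] and all [u] of type other than [c_i].  Together with the disjunctions
    [\/_u x_(i,u)], which for an assignment of weight [k] force exactly one [u]
    for every [i], this is a conjunction of large disjunctions of variables,
    hence a circuit of weft 2 and depth 2.  Patterns in which [v] is chosen
    twice are not allowed either, so that the chosen vertices are distinct.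

    The reduction runs the machines for [sigma] and [rho] on [0, ..., k], and
    then prints the circuit.  Its running time is bounded in terms of [k] by a
    computable function because the simulation counts its steps: the machine
    that computes the bound performs the same simulation. *)

Set Implicit Arguments.
Unset Strict Implicit.
Unset Printing Implicit Defensive.

(** Patterns of types keep the circuit small: there are [n.+1 ^ k] ways to fill the slots, but only
    [3 ^ k] patterns per vertex, so that [red_clauses] has at most [1 + k + n * (n + 3 ^ k)]
    entries.

    A word need not encode a graph. Such words must become no-instances, and do so by an empty
    clause, an [Or] without predecessors, which is printed when the length is not a square or the
    matrix is not symmetric with empty diagonal.

    The machines for [sigma] and [rho] cannot simply be inlined: they own their tapes, may use any
    registers, and their running times are given by no formula, while [fpt_reducible] asks for a
    computable bound. They are therefore interpreted step by step, each on its own untouched stretch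
    of memory. Correctness, termination and running time are proved together, in a calculus of
    weakest preconditions whose assertions see a clock. *)

Local Notation Sub := Defs.Sub.

(** * Structured programs *)

(* [Unless x c] runs [c] if register [x] is 0, and [Loop c x] repeats [c] until
   register [x] is 0: each takes a single conditional jump. *)
Inductive cmd :=
| Bas of instr
| Seq of cmd & cmd
| Unless of nat & cmd
| Loop of cmd & nat.

Coercion Bas : instr >-> cmd.
Local Notation "c ;; d" := (Seq c d) (at level 61, right associativity).

Fixpoint clen (c : cmd) : nat :=
  match c with
  | Bas _ => 1
  | Seq c d => clen c + clen d
  | Unless _ c => (clen c).+1
  | Loop c _ => (clen c).+1
  end.

Fixpoint compile (c : cmd) (o : nat) : program :=
  match c with
  | Bas i => [:: i]
  | Seq c d => compile c o ++ compile d (o + clen c)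
  | Unless x c => Jump x (o + (clen c).+1) :: compile c o.+1
  | Loop c x => compile c o ++ [:: Jump x o]
  end.

Lemma size_compile c o : size (compile c o) = clen c.
Proof.
by elim: c o => //= [c IHc d IHd | x c IHc | c IHc x] o;
  rewrite ?size_cat ?IHc ?IHd ?addn1.
Qed.

(* The last argument of an assertion is a clock, counting machine steps. *)
Definition assertion := (nat -> nat) -> seq nat -> seq nat -> nat -> Prop.

Fixpoint wp_loop (body : assertion -> assertion) (x : nat) (Q : assertion)
    (n : nat) : assertion :=
  if n is n'.+1 then
    body (fun X inp out t =>
      if 0 < X x then wp_loop body x Q n' X inp out t.+1
      else Q X inp out t.+1)
  else fun _ _ _ _ => False.

(** A bare [Jump] has precondition [False], so control flow arises from [Unless] and [Loop] only. A
    loop must come with a number of rounds after which it stops, so termination is part of the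
    meaning. *)
Fixpoint wp (c : cmd) (Q : assertion) : assertion :=
  match c with
  | Bas i => fun X inp out t =>
      match i with
      | Const i c => Q (upd X i c) inp out t.+1
      | Add i j l => Q (upd X i (X j + X l)) inp out t.+1
      | Sub i j l => Q (upd X i (X j - X l)) inp out t.+1
      | Fetch i j => Q (upd X i (X (X j))) inp out t.+1
      | Store i j => Q (upd X (X i) (X j)) inp out t.+1
      | Jump _ _ => False
      | Read i => Q (upd X i (head 0 inp)) (behead inp) out t.+1
      | Write i => Q X inp (rcons out (X i)) t.+1
      end
  | Seq c d => wp c (wp d Q)
  | Unless x c => fun X inp out t =>
      if 0 < X x then Q X inp out t.+1 else wp c Q X inp out t.+1
  | Loop c x => fun X inp out t =>
      exists n, wp_loop (wp c) x Q n X inp out t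
  end.

Lemma stepE p1 i p2 X inp out :
  step (p1 ++ i :: p2) (Config (size p1) X inp out) =
  exec i (Config (size p1) X inp out).
Proof.
rewrite /step /halted /= size_cat /= leqNgt addnS leq_addr /=.
by rewrite nth_cat ltnn subnn.
Qed.

(** Jump targets are absolute, so the induction is over code placed at offset [size p1] between
    arbitrary programs. As [dt] counts genuine machine steps, a bound on the clock in [Q] is a bound
    on the running time. *)
Lemma wp_sound c p1 p2 (Q : assertion) X inp out t :
  wp c Q X inp out t ->
  exists X' inp' out' dt, Q X' inp' out' (t + dt) /\
    iter dt (step (p1 ++ compile c (size p1) ++ p2))
      (Config (size p1) X inp out) =
    Config (size p1 + clen c) X' inp' out'.
Proof.
elim: c p1 p2 Q X inp out t => [i|c IHc d IHd|x c IHc|c IHc x]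
  p1 p2 Q X inp out t.
- have basic X' inp' out' : exec i (Config (size p1) X inp out) =
      Config (size p1).+1 X' inp' out' -> Q X' inp' out' t.+1 ->
      exists X' inp' out' dt, Q X' inp' out' (t + dt) /\
      iter dt (step (p1 ++ i :: p2)) (Config (size p1) X inp out) =
      Config (size p1 + 1) X' inp' out'.
    move=> eqX HQ; exists X', inp', out', 1; split; first by rewrite addn1.
    by rewrite /= stepE eqX addn1.
  by case: i basic => [? ?|? ? ?|? ? ?|? ?|? ?|? ?|?|?] /= b HQ;
    try exact: (b _ _ _ erefl HQ).
- have sz : size (p1 ++ compile c (size p1)) = size p1 + clen c.
    by rewrite size_cat size_compile.
  case/(IHc p1 (compile d (size p1 + clen c) ++ p2))
    => X1 [in1 [out1 [t1 [+ eq1]]]].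
  case/(IHd (p1 ++ compile c (size p1)) p2) => X2 [in2 [out2 [t2 [HQ eq2]]]].
  exists X2, in2, out2, (t2 + t1); split.
    by rewrite (_ : t + (t2 + t1) = t + t1 + t2) //; lia.
  rewrite iterD /= -catA eq1 addnA -sz; move: eq2.
  by rewrite sz -!catA.
- rewrite /=; have := stepE p1 (Jump x (size p1 + (clen c).+1))
    (compile c (size p1).+1 ++ p2) X inp out.
  rewrite /=; case: ifP => _ stp HQ.
    exists X, inp, out, 1; split; rewrite ?addn1 //= stp.
  case: (IHc (rcons p1 (Jump x (size p1 + (clen c).+1))) p2 _ _ _ _ _ HQ)
    => X' [inp' [out' [dt [HQ' eqr]]]].
  exists X', inp', out', dt.+1; split; first by rewrite addnS.
  move: eqr; rewrite size_rcons cat_rcons iterSr stp => ->.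
  by rewrite addnS.
- rewrite [wp _ _ _ _ _ _]/= => -[n].
  elim: n X inp out t => //= n IHn X inp out t.
  case/(IHc p1 (Jump x (size p1) :: p2)) => X1 [in1 [out1 [t1 [+ eq1]]]].
  have sz : size (p1 ++ compile c (size p1)) = size p1 + clen c.
    by rewrite size_cat size_compile.
  have := stepE (p1 ++ compile c (size p1)) (Jump x (size p1)) p2 X1 in1 out1.
  rewrite sz -!catA /=; case: ifP => _ stp.
    case/IHn => X2 [in2 [out2 [t2 [HQ eq2]]]].
    exists X2, in2, out2, (t2 + t1.+1); split.
      by rewrite (_ : t + (t2 + t1.+1) = (t + t1).+1 + t2) //; lia.
    by rewrite iterD iterS /= eq1 stp; move: eq2; rewrite -catA.
  exists X1, in1, out1, t1.+1; split; first by rewrite addnS.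
  by rewrite iterS /= eq1 stp addnS.
Qed.

Lemma wp_mono c (Q R : assertion) X inp out t :
  (forall X inp out t, Q X inp out t -> R X inp out t) ->
  wp c Q X inp out t -> wp c R X inp out t.
Proof.
elim: c Q R X inp out t => [i|c IHc d IHd|x c IHc|c IHc x]
  Q R X inp out t QR /=.
- by case: i => *; try apply: QR.
- by apply: IHc => *; apply: IHd QR _.
- by case: ifP => _; [apply: QR | apply: IHc].
- case=> n H; exists n; elim: n X inp out t H => //= n IHn X inp out t.
  by apply: IHc => X1 in1 out1 t1; case: ifP => _; [apply: IHn | apply: QR].
Qed.

Lemma wp_outputs c x (P : seq nat -> nat -> Prop) :
  wp c (fun _ _ => P) (fun=> 0) x [::] 0 ->
  exists y T, P y T /\ outputs_in (compile c 0) x y T.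
Proof.
case/(wp_sound [::] [::]) => X [inp [out [T [Py eqr]]]].
exists out, T; split=> //; rewrite /outputs_in /run; move: eqr.
by rewrite /= cats0 => ->; rewrite /halted /= size_compile.
Qed.

(* Registers 0, 1 and 2 hold the constants 1, 2 and 0; register 3 is scratch
   space for loop tests, and registers from 100 on form the heap. *)
Local Notation one := 0 (only parsing).
Local Notation two := 1 (only parsing).
Local Notation zero := 2 (only parsing).
Local Notation dif := 3 (only parsing).

(* [locked], here and below, stops [simpl] from unfolding the loops. *)
Definition For (i n : nat) (body : cmd) : cmd :=
  locked (Const i 0;; Sub dif one n;;
          Unless dif (Loop (body;; Add i i one;; Sub dif n i) dif)).

Lemma updE X i v : upd X i v i = v.
Proof. by rewrite /upd eqxx. Qed.

Lemma updN X i v j : j != i -> upd X i v j = X j.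
Proof. by rewrite /upd => /negPf->. Qed.

(** The three ticks added per round are the increment, the subtraction and the jump; the invariant
    must survive any value of [dif], which the loop test overwrites. *)
Lemma wp_for (I : nat -> assertion) i n body (Q : assertion) X inp out t :
  X one = 1 -> uniq [:: i; n; one; dif] ->
  (forall v, I 0 (upd (upd X i 0) dif v) inp out t.+3) ->
  (forall j X1 inp1 out1 t1, j < X n -> I j X1 inp1 out1 t1 ->
     X1 i = j -> X1 n = X n -> X1 one = 1 ->
     wp body (fun X2 inp2 out2 t2 => [/\ X2 i = j, X2 n = X n, X2 one = 1 &
       forall v, I j.+1 (upd (upd X2 i j.+1) dif v) inp2 out2 t2.+3])
       X1 inp1 out1 t1) ->
  (forall X1 inp1 out1 t1,
     I (X n) X1 inp1 out1 t1 -> Q X1 inp1 out1 t1) ->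
  wp (For i n body) Q X inp out t.
Proof.
move=> X1 uq I0 Ibody IQ.
have E Y v : (upd Y i v n = Y n) * (upd Y i v one = Y one) * (upd Y i v i = v) *
    (upd Y dif v i = Y i) * (upd Y dif v n = Y n) * (upd Y dif v one = Y one) *
    (upd Y dif v dif = v).
  move: uq; rewrite /= !inE !negb_or -!andbA => /and5P[? ? ? ? /andP[? _]].
  by rewrite !updE !updN // eq_sym.
(* [Loop] runs its body before testing, so an empty range is caught beforehand: the initial [dif],
   which is [1 - X n], is positive exactly when the bound is 0. *)
rewrite /For -lock /= !E X1; case: (posnP (X n)) => [n0 | n_gt0].
  by rewrite n0 /=; apply: IQ; rewrite n0; exact: I0.
rewrite (_ : 1 - X n = 0) /=; last by lia.
exists (X n).
have loop m j Y t0 inp0 out0 : 0 < m -> j + m = X n -> Y i = j -> Y n = X n ->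
    Y one = 1 -> I j Y inp0 out0 t0 ->
    wp_loop (wp (body;; Add i i one;; Sub dif n i)) dif Q m Y inp0 out0 t0.
  elim: m j Y t0 inp0 out0 => // m IH j Y t0 inp0 out0 _ jm Yi Yn Y1 IY /=.
  have ltj : j < X n by lia.
  apply: wp_mono (Ibody j _ _ _ _ ltj IY Yi Yn Y1).
  move=> Z inp1 out1 t1 [Zi Zn Z1 IZ] /=.
  rewrite !E Zi Z1 Zn addn1; case: ifP => lt; last first.
    by apply: IQ; rewrite (_ : X n = j.+1); [exact: IZ | lia].
  by apply: (IH j.+1); rewrite ?E //; first [lia | exact: IZ].
by apply: (loop _ 0); rewrite ?E //; exact: I0.
Qed.

Definition agree (V : seq nat) (X Y : nat -> nat) :=
  forall r, r \notin V -> X r = Y r.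

Lemma agree_refl V X : agree V X X.
Proof. by []. Qed.

Lemma agree_upd V X Y r v : r \in V -> agree V X Y -> agree V (upd X r v) Y.
Proof.
by move=> rV XY s sV; rewrite updN ?XY //; apply: contraNneq sV => ->.
Qed.

Lemma agree_trans V W X Y Z : agree V X Y -> all (mem W) V ->
  agree W Y Z -> agree W X Z.
Proof.
move=> XY /allP VW YZ r rW; rewrite XY ?YZ //.
by apply: contra rW => /VW.
Qed.

(* [acc] lists registers together with the values they hold after [j] rounds. *)
Definition track (acc : seq (nat * (nat -> nat))) (j : nat) (X : nat -> nat) :=
  foldr (fun p P => X p.1 = p.2 j /\ P) True acc.

Lemma eq_track acc j X Y : all (fun p => X p.1 == Y p.1) acc ->
  track acc j X -> track acc j Y.
Proof.
by elim: acc => //= p acc IH /andP[/eqP-> /IH{}IH] [-> /IH].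
Qed.

Lemma flatten_iotaS (T : Type) (F : nat -> seq T) j :
  flatten [seq F i | i <- iota 0 j.+1] =
  flatten [seq F i | i <- iota 0 j] ++ F j.
Proof. by rewrite -addn1 iotaD map_cat flatten_cat /= cats0. Qed.

(** The shape of nearly all loops below: round [j] prints the fixed string [F j] in at most [B]
    steps, changes only registers in [V], leaves the input alone and keeps the accumulators on the
    closed forms in [acc]. *)
Lemma wp_for_frame V acc (F : nat -> seq nat) B i n body (Q : assertion)
    X inp out t :
  X one = 1 ->
  [&& uniq [:: i; n; one; dif], n \notin V, one \notin V, i \in V, dif \in V &
    all (fun p => p.1 \notin [:: i; dif]) acc] ->
  track acc 0 X ->
  (forall j X1 out1 t1, j < X n -> agree V X1 X -> track acc j X1 -> X1 i = j ->
     wp body (fun X2 inp2 out2 t2 =>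
       [/\ agree V X2 X, X2 i = j, track acc j.+1 X2, inp2 = inp &
           out2 = out1 ++ F j /\ t2 <= t1 + B])
       X1 inp out1 t1) ->
  (forall X1 t1, agree V X1 X -> track acc (X n) X1 ->
     t1 <= t + X n * (B + 3) + 3 ->
     Q X1 inp (out ++ flatten [seq F j | j <- iota 0 (X n)]) t1) ->
  wp (For i n body) Q X inp out t.
Proof.
move=> X1 /and5P[uq nV oV iV /andP[dV accP]] a0 Hb HQ.
have tr j Y v w : track acc j Y -> track acc j (upd (upd Y i v) dif w).
  apply: eq_track; apply: sub_all accP => p; rewrite !inE negb_or.
  by case/andP=> pi pd; rewrite !updN.
pose I j : assertion := fun X1 inp1 out1 t1 =>
  [/\ agree V X1 X, track acc j X1, inp1 = inp,
      out1 = out ++ flatten [seq F j | j <- iota 0 j] &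
      t1 <= t + j * (B + 3) + 3].
apply: (wp_for (I := I)) => //.
- move=> v; split; rewrite ?cats0 //; last by lia.
  + by apply: agree_upd => //; apply: agree_upd.
  + exact: tr.
- move=> j Y inp1 out1 t1 ltj [aY trY -> {inp1}-> let1] Yi _ _.
  apply: wp_mono (Hb j Y _ t1 ltj aY trY Yi) => Z inp1 out2 t2.
  move=> [aZ Zi trZ -> [-> let2]]; split=> //.
  + by rewrite aZ.
  + by rewrite aZ.
  + move=> v; split=> //; last by lia.
    * by apply: agree_upd => //; apply: agree_upd.
    * exact: tr.
    * by rewrite flatten_iotaS catA.
- by move=> Y inp1 out1 t1 [aY trY -> -> let1]; apply: HQ.
Qed.

(** * Printing the circuit *)

Definition letters (s : seq bool) : seq nat :=
  [seq (nat_of_bool b).+1 | b <- s].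

Lemma letters_cat s s' : letters (s ++ s') = letters s ++ letters s'.
Proof. exact: map_cat. Qed.

(* [rtab] and [rmat] hold the addresses of the table of the allowed numbers of
   neighbours and of the adjacency matrix, [rN] the length of the input word,
   [rn] its square root rounded up, [rnn] the square of [rn], [rn1] its
   successor, [rNI] the number of circuit inputs, [rCC] the number [3 ^ k] of
   patterns, [rm] the number of clauses written so far, and [rrow] the address
   of the current row of the matrix. *)
Local Notation rk := 4 (only parsing).
Local Notation rtab := 5 (only parsing).
Local Notation rmat := 6 (only parsing).
Local Notation rN := 7 (only parsing).
Local Notation rn := 8 (only parsing).
Local Notation rnn := 9 (only parsing).
Local Notation rn1 := 10 (only parsing).
Local Notation rNI := 11 (only parsing).
Local Notation rCC := 12 (only parsing).
Local Notation rm := 13 (only parsing).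
Local Notation ri := 14 (only parsing).
Local Notation ru := 15 (only parsing).
Local Notation rv := 16 (only parsing).
Local Notation rc := 17 (only parsing).
Local Notation rq := 18 (only parsing).
Local Notation rg := 19 (only parsing).
Local Notation rself := 20 (only parsing).
Local Notation rnbr := 21 (only parsing).
Local Notation ridx := 22 (only parsing).
Local Notation rrow := 23 (only parsing).
Local Notation rcol := 24 (only parsing).
Local Notation rA := 25 (only parsing).
Local Notation rD := 26 (only parsing).
Local Notation rE := 27 (only parsing).
Local Notation rj := 28 (only parsing).
Local Notation rqd := 29 (only parsing).

(** On the tape [true] is the letter 2 and [false] the letter 1, whence the roles of the constants
    [two] and [one]. *)
Definition write_nat (x : nat) : cmd :=
  locked (For rj x (Write two);; Write one).

Ltac agrees := repeat match goal with
  | |- agree _ (upd _ _ _) _ => apply: agree_upd; first by []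
  | |- agree _ ?X ?X => exact: agree_refl
  | |- agree _ ?X ?Y => assumption
  | H : agree ?V ?X _ |- agree _ ?X _ => apply: (agree_trans H); first by []
  end.

(* Reads concrete registers through updates and [agree] hypotheses. *)
Ltac reads := repeat (cbv beta; match goal with
  | |- context [upd ?X ?i ?v ?i] => rewrite (updE X i v)
  | |- context [upd ?X ?i ?v ?j] =>
    rewrite (@updN X i v j (erefl true : is_true (j != i)))
  | H : agree _ ?X _ |- context [?X ?r] =>
    rewrite (H r (erefl true))
  end).

Lemma wp_Seq c d (Q : assertion) X inp out t :
  wp c (wp d Q) X inp out t -> wp (c;; d) Q X inp out t.
Proof. by []. Qed.

Lemma wp_Const v i c (Q : assertion) X inp out t :
  c = v -> Q (upd X i v) inp out t.+1 -> wp (Const i c) Q X inp out t.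
Proof. by move=> ->. Qed.

Lemma wp_Add v i j l (Q : assertion) X inp out t :
  X j + X l = v -> Q (upd X i v) inp out t.+1 -> wp (Add i j l) Q X inp out t.
Proof. by move=> <-. Qed.

Lemma wp_Sub v i j l (Q : assertion) X inp out t :
  X j - X l = v -> Q (upd X i v) inp out t.+1 -> wp (Sub i j l) Q X inp out t.
Proof. by move=> <-. Qed.

Lemma wp_Fetch a v i j (Q : assertion) X inp out t :
  X j = a -> X a = v -> Q (upd X i v) inp out t.+1 ->
  wp (Fetch i j) Q X inp out t.
Proof. by move=> <- <-. Qed.

Lemma wp_Store a v i j (Q : assertion) X inp out t :
  X i = a -> X j = v -> Q (upd X a v) inp out t.+1 ->
  wp (Store i j) Q X inp out t.
Proof. by move=> <- <-. Qed.

Lemma wp_Write v i (Q : assertion) X inp out t :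
  X i = v -> Q X inp (out ++ [:: v]) t.+1 -> wp (Write i) Q X inp out t.
Proof. by move=> <-; rewrite cats1. Qed.

Lemma wp_Unless x c (Q : assertion) X inp out t :
  (0 < X x -> Q X inp out t.+1) -> (X x = 0 -> wp c Q X inp out t.+1) ->
  wp (Unless x c) Q X inp out t.
Proof. by move=> H1 H2 /=; case: (posnP (X x)) => [/H2|/H1]. Qed.

(* [step tac] executes one instruction, after simplifying its operands by [tac]
   to keep the terms that describe the machine state small. *)
Ltac step tac :=
  repeat match goal with |- wp (Seq _ _) _ _ _ _ _ => apply wp_Seq end;
  match goal with
  | |- wp (Bas (Const _ _)) _ _ _ _ _ => eapply wp_Const; [reflexivity |]
  | |- wp (Bas (Add _ _ _)) _ _ _ _ _ =>
    eapply wp_Add; [reads; tac; reflexivity |]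
  | |- wp (Bas (Defs.Sub _ _ _)) _ _ _ _ _ =>
    eapply wp_Sub; [reads; tac; reflexivity |]
  | |- wp (Bas (Fetch _ _)) _ _ _ _ _ =>
    eapply wp_Fetch; [reads; tac; reflexivity | reads; tac; reflexivity |]
  | |- wp (Bas (Store _ _)) _ _ _ _ _ =>
    eapply wp_Store; [reads; tac; reflexivity | reads; tac; reflexivity |]
  | |- wp (Bas (Write _)) _ _ _ _ _ =>
    eapply wp_Write; [reads; tac; reflexivity |]
  end.

Lemma wp_write_nat x (Q : assertion) X inp out t :
  X one = 1 -> X two = 2 -> uniq [:: rj; x; one; dif] ->
  (forall X' t', agree [:: rj; dif] X' X -> t' <= t + 4 * X x + 4 ->
     Q X' inp (out ++ letters (nat_code (X x))) t') ->
  wp (write_nat x) Q X inp out t.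
Proof.
move=> X1 X2 uq HQ; rewrite /write_nat -lock /=.
apply: (wp_for_frame (V := [:: rj; dif]) (acc := [::])
         (F := fun=> [:: 2]) (B := 1)) => //.
- rewrite uq /=; move: uq; rewrite /= !inE !negb_or -!andbA.
  by case/and5P=> xj _ _ _ /andP[xd _]; rewrite eq_sym xj xd.
- move=> j Y out1 t1 _ aY _ Yj /=; split; [by [] | by [] | by [] | by [] | ].
  by rewrite -cats1 aY // X2 addn1.
- move=> Y t1 aY _ let1 /=; rewrite -cats1 aY // X1.
  move: (HQ Y t1.+1 aY); rewrite /nat_code letters_cat /= catA.
  set F1 := flatten _; set F2 := letters _.
  have -> : F1 = F2.
    rewrite /F1 /F2 /letters map_nseq; move: (iota _ _) (size_iota 0 (X x)).
    by elim: (X x) => [|m IH] [|? s] //= [/IH->].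
  by apply; lia.
Qed.

(** The machine cannot divide: [rg] counts modulo 3 while [rj] runs up to [rq], and each wrap-around
    at 3 increments the quotient [rqd]. *)
Definition div3 : cmd := locked (
  Const rqd 0;; Const rg 0;;
  For rj rq (Add rg rg one;; Const rD 2;; Sub rD rg rD;; Sub rD one rD;;
             Unless rD (Const rg 0;; Add rqd rqd one));;
  Add rq rqd zero).

Lemma wp_div3 (Q : assertion) X inp out t :
  X one = 1 -> X zero = 0 ->
  (forall X' t', agree [:: rqd; rg; rj; rD; rq; dif] X' X ->
     X' rg = X rq %% 3 -> X' rq = X rq %/ 3 -> t' <= t + 10 * X rq + 6 ->
     Q X' inp out t') ->
  wp div3 Q X inp out t.
Proof.
move=> X1 X0 HQ; rewrite /div3 -lock /=.
apply: (wp_for_frame (V := [:: rqd; rg; rj; rD; dif]) (F := fun=> [::])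
  (acc := [:: (rg, fun j => j %% 3); (rqd, fun j => j %/ 3)]) (B := 7)) => //.
- move=> j Y out1 t1 _ aY /= [gY [qY _]] Yj.
  reads; rewrite X1 gY qY; case: ifP => lt;
    (split; [by agrees | by reads | reads | by [] |
             rewrite cats0; split=> //; lia]);
    rewrite ?X1 ?gY ?qY; repeat split; lia.
- move=> Y t1 aY /=; reads=> -[gY [qY _]] let1.
  rewrite (_ : flatten _ = [::]) ?cats0; last by elim: (iota _ _).
  apply: HQ; reads; rewrite ?gY ?qY ?X0 ?addn0 //; [by agrees | lia].
Qed.

Definition gather (T : Type) (cl : nat -> seq T) (j : nat) : seq T :=
  flatten [seq cl i | i <- iota 0 j].

Lemma gatherS (T : Type) (cl : nat -> seq T) j :
  gather cl j.+1 = gather cl j ++ cl j.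
Proof. exact: flatten_iotaS. Qed.

Definition clauses_letters (cs : seq (seq nat)) : seq nat :=
  letters (flatten [seq true :: gate_code (Or c) | c <- cs]).

Lemma clauses_letters_cat cs cs' :
  clauses_letters (cs ++ cs') = clauses_letters cs ++ clauses_letters cs'.
Proof. by rewrite /clauses_letters map_cat flatten_cat letters_cat. Qed.

Lemma clauses_letters_gather (cl : nat -> seq (seq nat)) j :
  flatten [seq clauses_letters (cl i) | i <- iota 0 j] =
  clauses_letters (gather cl j).
Proof.
rewrite /gather; elim: (iota 0 j) => //= i s IH.
by rewrite clauses_letters_cat IH.
Qed.

(* [M] is the adjacency matrix by rows, with entries 2 for [true] and 1 for
   [false]; [tab (2 * d + s)] tells whether a vertex may have [d] neighbours
   in the dominating set, when [s = 1] if it is in the set itself. *)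
Record env (k n : nat) (M tab : nat -> nat) (X : nat -> nat) : Prop := Env {
  env1 : X one = 1;
  env2 : X two = 2;
  env0 : X zero = 0;
  env_k : X rk = k;
  env_n : X rn = n;
  env_n1 : X rn1 = n.+1;
  env_CC : X rCC = 3 ^ k;
  env_tab_ge : 100 <= X rtab;
  env_tab : forall a, a < k.*2.+2 -> X (X rtab + a) = tab a;
  env_mat_ge : 100 <= X rmat;
  env_mat : forall a, X (X rmat + a) = M a }.

Lemma updH X r v a : r < 100 -> 100 <= a -> upd X r v a = X a.
Proof. by move=> r_lt a_ge; rewrite updN //; lia. Qed.

Lemma agreeH V X Y a : agree V X Y -> all (ltn^~ 100) V -> 100 <= a ->
  X a = Y a.
Proof.
move=> XY /allP V100 a_ge; apply: XY; apply/negP => /V100 /=; lia.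
Qed.

Lemma env_agree V k n M tab X Y : env k n M tab X -> agree V Y X ->
  all (fun r => (r < 100) &&
    (r \notin [:: one; two; zero; rk; rn; rn1; rCC; rtab; rmat])) V ->
  env k n M tab Y.
Proof.
move=> eX aY; rewrite all_predI => /andP[V100 /allP Vd].
have E r : r \in [:: one; two; zero; rk; rn; rn1; rCC; rtab; rmat] -> Y r = X r.
  by move=> rE; apply: aY; apply/negP => /Vd; rewrite rE.
case: eX => *; split; rewrite ?E // => a; last rewrite (agreeH aY) //; try lia.
  by move=> ?; rewrite (agreeH aY) //; [auto | lia].
Qed.

Ltac envs E := rewrite ?(env1 E) ?(env2 E) ?(env0 E) ?(env_k E) ?(env_n E)
  ?(env_n1 E) ?(env_CC E).

(** The equality test of the programs: both truncated differences vanish exactly for equal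
    numbers. *)
Lemma eq_of_dist u v : 1 - (u - v + (v - u)) = (u == v).
Proof. by case: eqP => ?; lia. Qed.

(* the empty clause if [M] is not symmetric at [(u, v)] or has a loop there *)
Definition sym_cl (n : nat) (M : nat -> nat) (v u : nat) : seq (seq nat) :=
  let a := M (v * n + u) in let b := M (u * n + v) in
  nseq (0 < a - b + (b - a) + (a + (u == v) - 2)) [::].

(** The letters are the continuation bit of the gate list, the unary tag 2 of [Or], and the end of
    an empty list of predecessors. *)
Definition empty_clause : cmd :=
  Write two;; Write two;; Write two;; Write one;; Write one;; Add rm rm one.

Lemma wp_empty_clause w (Q : assertion) X inp out t :
  X one = 1 -> X two = 2 -> X rD = 1 - w ->
  (forall X' t', agree [:: rm] X' X -> X' rm = X rm + (0 < w) -> t' <= t + 7 ->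
     Q X' inp (out ++ clauses_letters (nseq (0 < w) [::])) t') ->
  wp (Unless rD empty_clause) Q X inp out t.
Proof.
move=> X1 X2 XD HQ; apply: wp_Unless; rewrite XD.
all: case: (posnP w) HQ => w0 HQ ?; try lia.
- move: (HQ X t.+1); rewrite cats0 addn0; apply=> //.
  by rewrite addnS ltnS leq_addr.
- rewrite /empty_clause; do 6!step ltac:(rewrite ?X1 ?X2).
  rewrite -!catA; apply: HQ.
  + by agrees.
  + by reads.
  + lia.
Qed.

(** For want of multiplication, [rcol] walks down column [v] in steps of [n] while [rrow + ru] runs
    along row [v]. *)
Definition sym_loop : cmd := locked (
  For ru rn (
    Add rA rrow ru;; Fetch rA rA;; Fetch rE rcol;;
    Sub rD rA rE;; Sub rE rE rA;; Add rD rD rE;;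
    Sub rE ru rv;; Sub rq rv ru;; Add rE rE rq;; Sub rE one rE;;
    Add rA rA rE;; Sub rA rA two;; Add rD rD rA;; Sub rD one rD;;
    Unless rD empty_clause;;
    Add rcol rcol rn)).

Lemma wp_sym_loop k n M tab v (Q : assertion) X inp out t :
  env k n M tab X -> X rv = v -> X rrow = X rmat + v * n -> X rcol = X rmat + v ->
  (forall X' t',
     agree [:: ru; rcol; rA; rD; rE; rq; rm; dif] X' X ->
     X' rm = X rm + size (gather (sym_cl n M v) n) ->
     t' <= t + 40 * n + 3 ->
     Q X' inp (out ++ clauses_letters (gather (sym_cl n M v) n)) t') ->
  wp sym_loop Q X inp out t.
Proof.
move=> eX Xv Xrow Xcol HQ; rewrite /sym_loop -lock.
apply: (wp_for_frame (V := [:: ru; rcol; rA; rD; rE; rq; rm; dif])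
  (acc := [:: (rcol, fun u => X rmat + (u * n + v));
              (rm, fun u => X rm + size (gather (sym_cl n M v) u))])
  (F := fun u => clauses_letters (sym_cl n M v u)) (B := 30)).
- by rewrite (env1 eX).
- by [].
- by rewrite /= Xcol addn0.
- move=> u Y out1 t1 ltu aY [colY [mY _]] Yu.
  have eY := env_agree eX aY erefl.
  have rA_ge : 100 <= X rmat + (v * n + u) by have := env_mat_ge eX; lia.
  have col_ge : 100 <= X rmat + (u * n + v) by have := env_mat_ge eX; lia.
  have rdM a : 100 <= X rmat + a -> Y (X rmat + a) = M a.
    by move=> ?; rewrite (agreeH aY) // (env_mat eX).
   step ltac:(rewrite Xrow Yu -addnA).
   step ltac:(rewrite ?updH ?rdM //).  step ltac:(rewrite ?colY ?updH ?rdM //).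
  do 3!step idtac.
  step ltac:(rewrite Yu Xv).
  step ltac:(rewrite Yu Xv).
  step idtac.
  step ltac:(rewrite (env1 eX) eq_of_dist).
  do 3!step ltac:(envs eX).
  set W := _ + _ + (_ - 2).
  step ltac:(envs eX).
  apply: wp_Seq; apply: (wp_empty_clause (w := W)).
  + by reads; envs eX.
  + by reads; envs eX.
  + by reads.
  + move=> Z t2 aZ mZ let2; step ltac:(rewrite colY (env_n eX)).
    split; [by agrees | by reads | | by [] | split=> //; lia].
    split; first by rewrite /=; reads; lia.
    split=> //=; reads; rewrite mZ; reads; rewrite mY /= gatherS size_cat.
    by rewrite size_nseq addnA.
- move=> Y t1 aY [_ [mY _]] let1; rewrite clauses_letters_gather.
  rewrite (env_n eX) in mY let1 *; apply: HQ => //; lia.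
Qed.

(** All costs are bounded by powers of one number [z] that exceeds every loop range. Constant
    factors are paid for by one more power, as [z] is at least 100. *)
Lemma pow_absorb z e a : 100 <= z -> a <= 50 * z ^ e -> a <= z ^ e.+1.
Proof. by move=> z_ge; rewrite expnS; nia. Qed.

(** Each nested loop raises the exponent by two: one power for the number of rounds, one for the
    overhead. *)
Lemma loop_cost z e n B : 100 <= z -> n <= z -> B <= z ^ e ->
  n * (B + 3) + 3 <= z ^ e.+2.
Proof.
move=> z_ge n_le B_le; rewrite !expnS.
have pos : 0 < z ^ e by rewrite expn_gt0; lia.
have : n * (B + 3) <= z * (4 * z ^ e) by apply: leq_mul; lia.
have : 100 * (z * z ^ e) <= z * (z * z ^ e) by rewrite leq_mul2r z_ge orbT.
have : 100 * 1 <= z * z ^ e by apply: leq_mul.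
rewrite mulnCA; lia.
Qed.

Definition lits_letters (s : seq nat) : seq nat :=
  letters (flatten [seq true :: nat_code i | i <- s]).

Lemma lits_letters_cat s s' :
  lits_letters (s ++ s') = lits_letters s ++ lits_letters s'.
Proof. by rewrite /lits_letters map_cat flatten_cat letters_cat. Qed.

Lemma lits_letters_gather (F : nat -> seq nat) j :
  flatten [seq lits_letters (F i) | i <- iota 0 j] = lits_letters (gather F j).
Proof.
rewrite /gather; elim: (iota 0 j) => //= i s IH.
by rewrite lits_letters_cat IH.
Qed.

Lemma letters_clause (c : seq nat) : clauses_letters [:: c] =
  [:: 2; 2; 2; 1] ++ lits_letters c ++ [:: 1].
Proof.
by rewrite /clauses_letters /= cats0 /seq_code letters_cat.
Qed.

(** A pattern is a number below [3 ^ k]; its base 3 digit at place [i] is the type prescribed for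
    slot [i]. *)
Definition digit (c i : nat) : nat := c %/ 3 ^ i %% 3.

(* The type of [u] with respect to [v]: 2 if [u] is [v] itself, 1 if it is a
   neighbour, and 0 otherwise. *)
Definition typ (n : nat) (M : nat -> nat) (v u : nat) : nat :=
  if u < n then M (v * n + u) - 1 + (u == v) + (u == v) else 0.

(** The variable [x_(i,u)] is input number [i * n.+1 + u]; these are the literals that slot [i]
    contributes to a clause when type [g] is prescribed. *)
Definition row_lits (n : nat) (M : nat -> nat) (v g i : nat) : seq nat :=
  gather (fun u => if typ n M v u == g then [::] else [:: i * n.+1 + u]) n.+1.

Definition row_loop : cmd := locked (
  For ru rn1 (
    Add rA rrow ru;; Fetch rA rA;; Sub rA rA one;;
    Sub rE ru rv;; Sub rD rv ru;; Add rE rE rD;; Sub rE one rE;;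
    Add rA rA rE;; Add rA rA rE;;
    Sub rD rn ru;; Unless rD (Const rA 0);;
    Sub rD rA rg;; Sub rE rg rA;; Add rD rD rE;; Sub rD one rD;;
    Unless rD (Write two;; write_nat ridx);;
    Add ridx ridx one)).

Lemma wp_row_loop z k n M tab v g i (Q : assertion) X inp out t :
  100 <= z -> k <= z -> n < z -> i < k ->
  env k n M tab X -> X rv = v -> X rrow = X rmat + v * n ->
  X rg = g -> X ridx = i * n.+1 ->
  (forall X' t',
     agree [:: ru; rA; rD; rE; ridx; rj; dif] X' X ->
     X' ridx = i.+1 * n.+1 -> t' <= t + z ^ 5 ->
     Q X' inp (out ++ lits_letters (row_lits n M v g i)) t') ->
  wp row_loop Q X inp out t.
Proof.
move=> z_ge kz nz ik eX Xv Xrow Xg Xidx HQ; rewrite /row_loop -lock.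
apply: (wp_for_frame (V := [:: ru; rA; rD; rE; ridx; rj; dif])
  (acc := [:: (ridx, fun u => i * n.+1 + u)])
  (F := fun u => lits_letters
     (if typ n M v u == g then [::] else [:: i * n.+1 + u])) (B := z ^ 3)).
- by rewrite (env1 eX).
- by [].
- by rewrite /= Xidx addn0.
- move=> u Y out1 t1; rewrite (env_n1 eX) => ltu aY [idxY _] Yu.
  have eY := env_agree eX aY erefl.
  have rA_ge : 100 <= X rmat + (v * n + u) by have := env_mat_ge eX; lia.
  have rdM a : 100 <= X rmat + a -> Y (X rmat + a) = M a.
    by move=> ?; rewrite (agreeH aY) // (env_mat eX).
  step ltac:(rewrite Xrow Yu -addnA).
  step ltac:(rewrite ?updH ?rdM //).
  step ltac:(envs eX).
  step ltac:(rewrite Yu Xv).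
  step ltac:(rewrite Yu Xv).
  step idtac.
  step ltac:(rewrite (env1 eX) eq_of_dist).
  do 2!step idtac.
  (* For [u = n] the cell just read lies outside row [v]. Exactly then [n - u] is 0, and the type is
     reset to 0, as befits an empty slot. *)
  step ltac:(rewrite (env_n eX) Yu).
  set W := upd (upd _ _ _) _ _.
  have aW : agree [:: rA; rD; rE] W Y by rewrite /W; agrees.
  have WA : W rA = M (v * n + u) - 1 + (u == v) + (u == v) by rewrite /W; reads.
  have WD : W rD = n - u by rewrite /W; reads.
  clearbody W.
  apply: wp_Seq; apply: (@wp_mono _ (fun Z inp2 out2 t2 =>
    [/\ agree [:: rA; rD; rE] Z Y, Z rA = typ n M v u, inp2 = inp, out2 = out1 &
        t2 <= t1 + 12])); last first.
    apply: wp_Unless; rewrite /typ WD => Hu; last step idtac;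
      (split; [by agrees | | by [] | by [] | by lia]).
    + by rewrite WA (_ : u < n) //; lia.
    + by reads; rewrite ltnNge -subn_eq0 Hu.
  move=> {WA WD}Z inp2 out2 t2 [aZ ZA -> -> let2].
  step ltac:(rewrite ZA Xg).
  step ltac:(rewrite ZA Xg).
  step idtac.
  step ltac:(rewrite (env1 eX) eq_of_dist).
  apply: wp_Seq; apply: (@wp_mono _ (fun Z' inp3 out3 t3 =>
    [/\ agree [:: rA; rD; rE; rj; dif] Z' Y, inp3 = inp,
        out3 = out1 ++ lits_letters
          (if typ n M v u == g then [::] else [:: i * n.+1 + u]) &
        t3 <= t1 + 30 + 4 * (i * n.+1 + u)])); last first.
    apply: wp_Unless; reads; case: (_ == g) => // _.
    + by split; [agrees | | rewrite /lits_letters /= cats0 | lia].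
    + step ltac:(rewrite (env2 eX)).
      apply: wp_write_nat => //; [by reads; envs eX | by reads; envs eX | ].
      move=> Z' t3 aZ'; reads; rewrite idxY -catA => let3.
      by split; [agrees | | rewrite /lits_letters /= cats0 |
                 move: let3; rewrite /=; lia].
  move=> {aZ ZA let2} {}Z inp3 out3 t3 [aZ -> -> let3].
  step ltac:(rewrite idxY (env1 eX)).
  split; [by agrees | by reads | | by [] | split=> //].
  + by split=> //=; rewrite updE addn1 addnS.
  (* The literal is printed in unary, and its number is below [z * z]. *)
  + have lez : i.+1 * n.+1 <= z * z by apply: leq_mul; lia.
    move: lez; rewrite mulSn => lez.
    suff : 30 + 4 * (z * z) + 1 <= z ^ 3 by lia.
    apply: pow_absorb => //; rewrite expnS expn1; nia.
- rewrite (env_n1 eX) => Y t1 aY [idxY _] let1.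
  rewrite lits_letters_gather; apply: HQ => //.
    by rewrite idxY /= mulSn addnC.
  apply: (leq_trans let1); rewrite -addnA leq_add2l.
  exact: loop_cost.
Qed.

Definition pat_clause (k n : nat) (M : nat -> nat) (v c : nat) : seq nat :=
  gather (fun i => row_lits n M v (digit c i) i) k.

Lemma digitS c i : c %/ 3 ^ i %/ 3 = c %/ 3 ^ i.+1.
Proof. by rewrite -divnMA expnSr. Qed.

(** Each [div3] splits off the next digit of the pattern. The variable number [ridx] is never reset,
    since the block of slot [i.+1] begins where that of slot [i] ends. *)
Definition clause_loop : cmd := locked (For ri rk (div3;; row_loop)).

Lemma wp_clause_loop z k n M tab v c (Q : assertion) X inp out t :
  100 <= z -> k <= z -> n < z -> c <= z ->
  env k n M tab X -> X rv = v -> X rrow = X rmat + v * n ->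
  X rq = c -> X ridx = 0 ->
  (forall X' t',
     agree [:: ri; ru; rq; rg; rqd; rA; rD; rE; ridx; rj; dif] X' X ->
     t' <= t + z ^ 8 ->
     Q X' inp (out ++ lits_letters (pat_clause k n M v c)) t') ->
  wp clause_loop Q X inp out t.
Proof.
move=> z_ge kz nz cz eX Xv Xrow Xq Xidx HQ; rewrite /clause_loop -lock.
apply: (wp_for_frame
  (V := [:: ri; ru; rq; rg; rqd; rA; rD; rE; ridx; rj; dif])
  (acc := [:: (rq, fun i => c %/ 3 ^ i); (ridx, fun i => i * n.+1)])
  (F := fun i => lits_letters (row_lits n M v (digit c i) i)) (B := z ^ 6)).
- by rewrite (env1 eX).
- by [].
- by rewrite /= Xidx Xq divn1.
- move=> i Y out1 t1; rewrite (env_k eX) => ltu aY [qY [idxY _]] Yi.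
  have eY := env_agree eX aY erefl.
  apply: wp_Seq; apply: wp_div3; rewrite ?(env1 eY) ?(env0 eY) //.
  move=> Z t2 aZ gZ qZ let2; have eZ := env_agree eY aZ erefl.
  apply: (wp_row_loop (z := z) (v := v) (i := i) _ _ _ _ eZ) => //; reads => //.

  rewrite gZ qY => W t3 aW idxW let3; split.
  + by agrees.
  + by reads.
  + by rewrite /= idxW; reads; rewrite qZ qY /= digitS.
  + by [].
  + split=> //.
    have : Y rq <= z by rewrite qY (leq_trans (leq_div _ _)).
    have : 100 <= z ^ 5.
      by apply: leq_trans z_ge _; rewrite -{1}[z]expn1 leq_pexp2l; lia.
    have : z <= z ^ 5 by rewrite -{1}[z]expn1 leq_pexp2l; lia.
    move=> le1 le2 le3.
    have : 50 * z ^ 5 <= z ^ 6 by apply: pow_absorb.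
    lia.
- rewrite (env_k eX) => Y t1 aY _ let1.
  rewrite lits_letters_gather; apply: HQ => //.
  apply: (leq_trans let1); rewrite -addnA leq_add2l.
  exact: loop_cost.
Qed.

Definition count_digit (g c j : nat) : nat :=
  count (fun i => digit c i == g) (iota 0 j).

Lemma count_digitS g c j :
  count_digit g c j.+1 = count_digit g c j + (digit c j == g).
Proof. by rewrite /count_digit -addn1 iotaD count_cat /= addn0. Qed.

(** For a digit [g < 3], the truncated [g - 1] is the indicator of 2, and [g - 2 * (g - 1)] that of
    1. *)
Definition count_loop : cmd := locked (
  For ri rk (div3;; Sub rD rg one;; Add rself rself rD;;
             Add rnbr rnbr rg;; Sub rnbr rnbr rD;; Sub rnbr rnbr rD)).

Lemma wp_count_loop z k n M tab c (Q : assertion) X inp out t :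
  100 <= z -> k <= z -> c <= z ->
  env k n M tab X -> X rq = c -> X rself = 0 -> X rnbr = 0 ->
  (forall X' t',
     agree [:: ri; rq; rg; rqd; rD; rj; rself; rnbr; dif] X' X ->
     X' rself = count_digit 2 c k -> X' rnbr = count_digit 1 c k ->
     t' <= t + z ^ 4 -> Q X' inp out t') ->
  wp count_loop Q X inp out t.
Proof.
move=> z_ge kz cz eX Xq Xself Xnbr HQ; rewrite /count_loop -lock.
apply: (wp_for_frame (V := [:: ri; rq; rg; rqd; rD; rj; rself; rnbr; dif])
  (acc := [:: (rq, fun i => c %/ 3 ^ i); (rself, count_digit 2 c);
              (rnbr, count_digit 1 c)])
  (F := fun=> [::]) (B := z ^ 2)).
- by rewrite (env1 eX).
- by [].
- by rewrite /= Xq Xself Xnbr divn1.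
- move=> i Y out1 t1; rewrite (env_k eX) => ltu aY [qY [sY [nY _]]] Yi.
  have eY := env_agree eX aY erefl.
  apply: wp_Seq; apply: wp_div3; rewrite ?(env1 eY) ?(env0 eY) //.
  move=> Z t2 aZ gZ qZ let2; have eZ := env_agree eY aZ erefl.
  step ltac:(envs eX).
  step ltac:(rewrite sY).
  step ltac:(rewrite nY).
  do 2!step idtac.
  have gE : Z rg = digit c i by rewrite gZ qY.
  have g3 : digit c i < 3 by rewrite ltn_mod.
  split; [by agrees | by reads | | by [] | split].
  + rewrite /=; reads; rewrite qZ qY /= digitS !count_digitS gE.
    by case: (digit c i) g3 => [|[|[|//]]] _; repeat split; lia.
  + by rewrite cats0.
  + have : Y rq <= z by rewrite qY (leq_trans (leq_div _ _)).
    have : 50 * z ^ 1 <= z ^ 2 by apply: pow_absorb.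
    rewrite expn1; lia.
- rewrite (env_k eX) => Y t1 aY [_ [sY [nY _]]] let1.
  rewrite (_ : flatten _ = [::]) ?cats0; last by elim: (iota _ _).
  apply: HQ => //; apply: (leq_trans let1); rewrite -addnA leq_add2l.
  exact: loop_cost.
Qed.

(* A pattern [c] is bad when its number of 2's exceeds 1, or when the table
   forbids its numbers of 1's and 2's. *)
Definition pat_cl (k n : nat) (M tab : nat -> nat) (v c : nat) :
    seq (seq nat) :=
  let nb := count_digit 1 c k in let sf := count_digit 2 c k in
  nseq (tab (nb.*2 + sf) <= sf - 1) (pat_clause k n M v c).

(** Keeps the address [nb.*2 + sf] within the [k.*2.+2] entries of the table. *)
Lemma count_digit_sum c k : count_digit 1 c k + count_digit 2 c k <= k.
Proof.
elim: k => // k IH; rewrite !count_digitS.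
by case: (digit c k) => [|[|[|?]]] /=; lia.
Qed.

Definition pat_loop : cmd := locked (
  For rc rCC (
    Add rq rc zero;; Const rself 0;; Const rnbr 0;; count_loop;;
    Add rA rnbr rnbr;; Add rA rA rself;; Add rA rtab rA;; Fetch rD rA;;
    Sub rA rself one;; Sub rD rD rA;;
    Unless rD (
      Write two;; Write two;; Write two;; Write one;;
      Const ridx 0;; Add rq rc zero;; clause_loop;;
      Write one;; Add rm rm one))).

Lemma wp_pat_loop z k n M tab v (Q : assertion) X inp out t :
  100 <= z -> k <= z -> n < z -> 3 ^ k <= z ->
  env k n M tab X -> X rv = v -> X rrow = X rmat + v * n ->
  (forall X' t',
     agree [:: rc; ri; ru; rq; rg; rqd; rself; rnbr; rA; rD; rE; ridx; rj; rm;
               dif] X' X ->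
     X' rm = X rm + size (gather (pat_cl k n M tab v) (3 ^ k)) ->
     t' <= t + z ^ 11 ->
     Q X' inp (out ++ clauses_letters (gather (pat_cl k n M tab v) (3 ^ k))) t') ->
  wp pat_loop Q X inp out t.
Proof.
move=> z_ge kz nz cz eX Xv Xrow HQ; rewrite /pat_loop -lock.
apply: (wp_for_frame
  (V := [:: rc; ri; ru; rq; rg; rqd; rself; rnbr; rA; rD; rE; ridx; rj; rm; dif])
  (acc := [:: (rm, fun c => X rm + size (gather (pat_cl k n M tab v) c))])
  (F := fun c => clauses_letters (pat_cl k n M tab v c)) (B := z ^ 9)).
- by rewrite (env1 eX).
- by [].
- by rewrite /= addn0.
- move=> c Y out1 t1; rewrite (env_CC eX) => ltc aY [mY _] Yc.
  have eY := env_agree eX aY erefl.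
  step ltac:(rewrite Yc (env0 eX) addn0).
  do 2!step idtac.
  set W := upd (upd _ _ _) _ _.
  have aW : agree [:: rq; rself; rnbr] W Y by rewrite /W; agrees.
  have eW := env_agree eY aW erefl.
  apply: wp_Seq; apply: (wp_count_loop z_ge kz (c := c) _ eW);
    rewrite /W; reads => //; first lia.
  move=> Z t2 aZ selfZ nbrZ let2; have {eW} eZ := env_agree eW aZ erefl.
  have {}aZ : agree [:: ri; rq; rg; rqd; rD; rj; rself; rnbr; dif] Z Y by agrees.
  clear W aW.
  have tabZ a : a < k.*2.+2 -> Z (X rtab + a) = tab a.
    by move=> lt_a; rewrite -(env_tab eZ) //; reads.
  have c_sum := count_digit_sum c k.
  have tab_ge := env_tab_ge eX.
  step ltac:(rewrite nbrZ addnn).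
  step ltac:(rewrite selfZ).
  step idtac.
  step ltac:(rewrite ?updH ?tabZ //; try lia).
  step ltac:(rewrite selfZ (env1 eX)).
  step idtac.
  set W := upd (upd _ _ _) _ _.
  have aW : agree [:: rA; rD] W Z by rewrite /W; agrees.
  have mW : W rm = Y rm by rewrite /W; reads.
  have eW := env_agree eZ aW erefl.
  have aWX : agree [:: rc; ri; ru; rq; rg; rqd; rself; rnbr; rA; rD; rE; ridx;
                      rj; rm; dif] W X.
    by agrees.
  have : W rD = tab ((count_digit 1 c k).*2 + count_digit 2 c k) -
    (count_digit 2 c k - 1) by rewrite /W; reads.
  clearbody W => WD.
  have pw : 50 * z ^ 8 <= z ^ 9 by apply: pow_absorb.
  have pw4 : z ^ 4 <= z ^ 8 by rewrite leq_pexp2l; lia.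
  have pw1 : z <= z ^ 8 by rewrite -{1}[z]expn1 leq_pexp2l; lia.
  apply: wp_Unless; rewrite WD => hD.
    have -> : pat_cl k n M tab v c = [::] by rewrite /pat_cl leqNgt -subn_gt0 hD.
    split; [by agrees | by reads | | by [] | ].
    + by rewrite /= mW mY gatherS size_cat /pat_cl leqNgt -subn_gt0 hD addn0.
    + by rewrite cats0; split=> //; lia.
  have catE : pat_cl k n M tab v c = [:: pat_clause k n M v c].
    by rewrite /pat_cl -subn_eq0 hD.
  do 4!step ltac:(envs eX).
  step idtac.
  step ltac:(rewrite Yc (env0 eX) addn0).
  set U := upd (upd _ _ _) _ _.
  have aU : agree [:: rq; ridx] U W by rewrite /U; agrees.
  have eU := env_agree eW aU erefl.
  apply: wp_Seq; apply: (wp_clause_loop (v := v) (c := c) z_ge kz nz _ eU);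
    try by [rewrite /U; reads | lia].
  move=> U' t3 aU' let3.
  have {}aU' : agree [:: ri; ru; rq; rg; rqd; rA; rD; rE; ridx; rj; dif] U' W.
    by agrees.
  clear U aU eU.
  do 2!step ltac:(envs eX).
  split; [by agrees | by reads | | by [] | ].
  + by split=> //=; reads; rewrite (mY : Y rm = _) gatherS size_cat catE /= addnA.
  + rewrite catE letters_clause -!catA; split=> //; lia.
- rewrite (env_CC eX) => Y t1 aY [mY _] let1.
  rewrite clauses_letters_gather; apply: HQ => //.
  apply: (leq_trans let1); rewrite -addnA leq_add2l.
  exact: loop_cost.
Qed.

Definition vertex_cl (k n : nat) (M tab : nat -> nat) (v : nat) : seq (seq nat) :=
  gather (sym_cl n M v) n ++ gather (pat_cl k n M tab v) (3 ^ k).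

Definition vertex_loop : cmd := locked (
  For rv rn (Add rcol rmat rv;; sym_loop;; pat_loop;; Add rrow rrow rn)).

Local Notation work := [:: rv; rrow; rcol; rc; ri; ru; rq; rg; rqd; rself; rnbr; rA;
  rD; rE; ridx; rj; rm; dif] (only parsing).

Lemma wp_vertex_loop z k n M tab (Q : assertion) X inp out t :
  100 <= z -> k <= z -> n < z -> 3 ^ k <= z ->
  env k n M tab X -> X rrow = X rmat ->
  (forall X' t',
     agree work X' X -> X' rm = X rm + size (gather (vertex_cl k n M tab) n) ->
     t' <= t + z ^ 14 ->
     Q X' inp (out ++ clauses_letters (gather (vertex_cl k n M tab) n)) t') ->
  wp vertex_loop Q X inp out t.
Proof.
move=> z_ge kz nz cz eX Xrow HQ; rewrite /vertex_loop -lock.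
apply: (wp_for_frame (V := work)
  (acc := [:: (rrow, fun v => X rmat + v * n);
              (rm, fun v => X rm + size (gather (vertex_cl k n M tab) v))])
  (F := fun v => clauses_letters (vertex_cl k n M tab v)) (B := z ^ 12)).
- by rewrite (env1 eX).
- by [].
- by rewrite /= !addn0.
- move=> v Y out1 t1; rewrite (env_n eX) => ltv aY [rowY [mY _]] Yv.
  have eY := env_agree eX aY erefl.
  step ltac:(rewrite Yv).
  set W := upd _ _ _.
  have aW : agree [:: rcol] W Y by rewrite /W; agrees.
  have eW := env_agree eY aW erefl.
  apply: wp_Seq; apply: (wp_sym_loop (v := v) eW).
  + by reads.
  + by reads; rewrite rowY.
  + by rewrite /W; reads.
  move=> Z t2 aZ mZ let2; have eZ := env_agree eW aZ erefl.
  have {}mZ : Z rm = Y rm + size (gather (sym_cl n M v) n) by rewrite mZ; reads.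
  apply: wp_Seq; apply: (wp_pat_loop (v := v) z_ge kz nz cz eZ).
  + by reads.
  + by reads; rewrite rowY.
  move=> U t3 aU mU let3.
  step ltac:(rewrite rowY (env_n eX)).
  split; [by agrees | by reads | | by [] | ].
  + split; first by rewrite /=; reads; lia.
    split=> //=; reads; rewrite mU mZ (mY : Y rm = _) gatherS size_cat.
    by rewrite (size_cat (gather (sym_cl n M v) n)) !addnA.
  + rewrite clauses_letters_cat catA; split=> //.
    have : 50 * z ^ 11 <= z ^ 12 by apply: pow_absorb.
    have : z <= z ^ 11 by rewrite -{1}[z]expn1 leq_pexp2l; lia.
    lia.
- rewrite (env_n eX) => Y t1 aY [_ [mY _]] let1.
  rewrite clauses_letters_gather; apply: HQ => //.
  apply: (leq_trans let1); rewrite -addnA leq_add2l.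
  by apply: loop_cost => //; lia.
Qed.

Definition lits_loop (x : nat) : cmd := locked (
  For ru x (Write two;; write_nat ridx;; Add ridx ridx one)).

Lemma wp_lits_loop x b l (Q : assertion) X inp out t :
  x \notin [:: one; dif; ru; ridx; rj] ->
  X one = 1 -> X two = 2 -> X ridx = b -> X x = l ->
  (forall X' t', agree [:: ru; ridx; rj; dif] X' X -> X' ridx = b + l ->
     t' <= t + l * (4 * (b + l) + 9) + 3 ->
     Q X' inp (out ++ lits_letters (iota b l)) t') ->
  wp (lits_loop x) Q X inp out t.
Proof.
rewrite !inE !negb_or => /and5P[x1 xd xu xidx xj] X1 X2 Xidx Xx HQ.
rewrite /lits_loop -lock.
apply: (wp_for_frame (V := [:: ru; ridx; rj; dif])
  (acc := [:: (ridx, fun u => b + u)])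
  (F := fun u => lits_letters [:: b + u]) (B := 4 * (b + l) + 6)) => //.
- rewrite /= !inE !negb_or x1 xd xu xidx xj /=.
  by rewrite !(eq_sym _ x) xu.
- by rewrite /= addn0.
- move=> u Y out1 t1; rewrite Xx => ltu aY [idxY _] Yu.
  step ltac:(rewrite X2).
  apply: wp_Seq; apply: wp_write_nat; [by reads | by reads | by [] |].
  move=> Z t2 aZ; rewrite (idxY : Y ridx = _) => let2.
  step ltac:(rewrite (idxY : Y ridx = _) X1).
  split; [by agrees | by reads | | by [] | ].
  + by split=> //=; rewrite updE; lia.
  + rewrite -catA /lits_letters /= cats0; split=> //; rewrite /= in let2; lia.
- rewrite Xx => Y t1 aY [idxY _] let1.
  rewrite lits_letters_gather.
  have -> : gather (fun u => [:: b + u]) l = iota b l.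
    rewrite /gather -[b in RHS]addn0 iotaDl.
    by elim: (iota 0 l) => //= ? ? ->.
  by apply: HQ => //; lia.
Qed.

Definition fun_cl (n i : nat) : seq (seq nat) := [:: iota (i * n.+1) n.+1].

Definition fun_loop : cmd := locked (
  For ri rk (Write two;; Write two;; Write two;; Write one;;
             lits_loop rn1;; Write one;; Add rm rm one)).

Lemma wp_fun_loop z k n M tab (Q : assertion) X inp out t :
  100 <= z -> k <= z -> n < z ->
  env k n M tab X -> X ridx = 0 ->
  (forall X' t',
     agree [:: ri; ru; ridx; rj; rm; dif] X' X ->
     X' rm = X rm + size (gather (fun_cl n) k) -> t' <= t + z ^ 6 ->
     Q X' inp (out ++ clauses_letters (gather (fun_cl n) k)) t') ->
  wp fun_loop Q X inp out t.
Proof.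
move=> z_ge kz nz eX Xidx HQ; rewrite /fun_loop -lock.
apply: (wp_for_frame (V := [:: ri; ru; ridx; rj; rm; dif])
  (acc := [:: (ridx, fun i => i * n.+1);
              (rm, fun i => X rm + size (gather (fun_cl n) i))])
  (F := fun i => clauses_letters (fun_cl n i)) (B := z ^ 4)).
- by rewrite (env1 eX).
- by [].
- by rewrite /= Xidx addn0.
- move=> i Y out1 t1; rewrite (env_k eX) => lti aY [idxY [mY _]] Yi.
  have eY := env_agree eX aY erefl.
  do 4!step ltac:(envs eX).
  apply: wp_Seq; apply: (wp_lits_loop (b := i * n.+1) (l := n.+1)) => //;
    rewrite ?(env1 eY) ?(env2 eY) ?(env_n1 eY) //.
  move=> Z t2 aZ idxZ let2.
  do 2!step ltac:(envs eX).
  split; [by agrees | by reads | | by [] | ].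
  + split; first by rewrite /=; reads; rewrite idxZ mulSn addnC.
    split=> //; transitivity (X rm + (size (gather (fun_cl n) i) + 1)).
      by rewrite [LHS]/=; reads; rewrite (mY : Y rm = _) addnA.
    have := size_cat (gather (fun_cl n) i) (fun_cl n i).
    by rewrite -gatherS => <-.
  + rewrite letters_clause -!catA; split=> //.
    have : i * n.+1 + n.+1 <= z * z.
      by rewrite -{2}[n.+1]mul1n -mulnDl addn1; apply: leq_mul; lia.
    have : 50 * z ^ 3 <= z ^ 4 by apply: pow_absorb.
    have : z * (4 * (z * z) + 9) <= 10 * z ^ 3 by rewrite !expnS expn0; nia.
    have : n.+1 * (4 * (i * n.+1 + n.+1) + 9) <= z * (4 * (i * n.+1 + n.+1) + 9).
      by rewrite leq_mul2r nz orbT.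
    have : 100 <= z ^ 3 by rewrite !expnS expn0; nia.
    nia.
- rewrite (env_k eX) => Y t1 aY [_ [mY _]] let1.
  rewrite clauses_letters_gather; apply: HQ => //.
  apply: (leq_trans let1); rewrite -addnA leq_add2l.
  exact: loop_cost.
Qed.

(** * The complete circuit *)

(** With [N] the length of the word and [n] its square root rounded up, the first term is an empty
    clause exactly when [N] is not a square. *)
Definition red_clauses (k n N : nat) (M tab : nat -> nat) : seq (seq nat) :=
  nseq (0 < n * n - N) [::] ++ gather (fun_cl n) k ++
  gather (vertex_cl k n M tab) n.

Definition cnf_circuit (ni : nat) (cls : seq (seq nat)) : circuit :=
  Circuit ni (rcons [seq Or c | c <- cls] (And (iota ni (size cls))))
    (ni + size cls).

Lemma letters_cnf_circuit ni cls :
  letters (circuit_code (cnf_circuit ni cls)) =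
  letters (nat_code ni) ++ clauses_letters cls ++ [:: 2; 2; 1] ++
  lits_letters (iota ni (size cls)) ++ [:: 1; 1] ++
  letters (nat_code (ni + size cls)).
Proof.
rewrite /circuit_code !letters_cat /=; congr (_ ++ _).
rewrite /seq_code map_rcons -cats1 flatten_cat -map_comp !letters_cat -!catA.
by congr (_ ++ _); rewrite /= /seq_code letters_cat -catA.
Qed.

Lemma size_gather_le (T : Type) (F : nat -> seq T) B j :
  (forall i, size (F i) <= B) -> size (gather F j) <= j * B.
Proof.
move=> FB; elim: j => // j IH; rewrite gatherS size_cat mulSn addnC.
exact: leq_add.
Qed.

(** Bounds the fan-in of the output gate, whose predecessors are listed one by one in unary. *)
Lemma size_red_clauses z k n N M tab :
  100 <= z -> k <= z -> n < z -> 3 ^ k <= z ->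
  size (red_clauses k n N M tab) <= z ^ 3.
Proof.
move=> z_ge kz nz cz; rewrite /red_clauses !size_cat size_nseq.
have le1 : size (gather (fun_cl n) k) <= k * 1 by apply: size_gather_le.
have le2 v : size (vertex_cl k n M tab v) <= n + 3 ^ k.
  rewrite size_cat -[n in leqRHS]muln1 -[3 ^ k in leqRHS]muln1.
  by apply: leq_add; apply: size_gather_le => i; rewrite size_nseq leq_b1.
have le3 := size_gather_le n le2.
apply: pow_absorb => //; rewrite expnS expn1.
have : n * (n + 3 ^ k) <= z * (z + z) by apply: leq_mul; lia.
nia.
Qed.

(** Lists are coded with continuation bits, so the number of clauses need not be known in advance:
    [rm] counts them for the final [And]. After its predecessors are listed, [ridx] has reached the
    number of the output node. *)
Definition generate : cmd := locked (
  Write rk;; write_nat rNI;; Const rm 0;;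
  Sub rD rnn rN;; Sub rD one rD;; Unless rD empty_clause;;
  Const ridx 0;; fun_loop;; Add rrow rmat zero;; vertex_loop;;
  Write two;; Write two;; Write one;; Add ridx rNI zero;; lits_loop rm;;
  Write one;; Write one;; write_nat ridx).

Lemma wp_generate z k n N M tab (Q : assertion) X inp out t :
  100 <= z -> k <= z -> n < z -> 3 ^ k <= z ->
  env k n M tab X -> X rN = N -> X rnn = n * n -> X rNI = k * n.+1 ->
  (forall X' t', t' <= t + z ^ 16 ->
     Q X' inp (out ++ k :: letters (circuit_code
       (cnf_circuit (k * n.+1) (red_clauses k n N M tab)))) t') ->
  wp generate Q X inp out t.
Proof.
move=> z_ge kz nz cz eX XN Xnn XNI HQ; rewrite /generate -lock.
have pw i j : i <= j -> z ^ i <= z ^ j by move=> ij; rewrite leq_pexp2l //; lia.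
step ltac:(envs eX).
apply: wp_Seq; apply: wp_write_nat; rewrite ?(env1 eX) ?(env2 eX) // XNI.
move=> Y t1 aY let1; have eY := env_agree eX aY erefl.
step idtac.
step ltac:(rewrite Xnn XN).
step ltac:(envs eX).
apply: wp_Seq; apply: (wp_empty_clause (w := n * n - N)).
+ by reads; envs eX.
+ by reads; envs eX.
+ by reads.
move=> Z t2 aZ; reads; rewrite add0n => mZ let2.
have {}aZ : agree [:: rj; dif; rm; rD] Z X by agrees.
have eZ := env_agree eX aZ erefl.
have {t1 aY eY let1}let2 : t2 <= t + 4 * (k * n.+1) + 20 by lia.
step idtac.
set W := upd _ _ _; have aW : agree [:: ridx] W Z by rewrite /W; agrees.
have eW := env_agree eZ aW erefl.
apply: wp_Seq; apply: (wp_fun_loop z_ge kz nz eW); first by rewrite /W; reads.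
move=> {}Y t3 aY mY let3; have eY := env_agree eW aY erefl.
have {}mY : Y rm = (0 < n * n - N) + size (gather (fun_cl n) k).
  by rewrite mY; reads; rewrite mZ.
have {Z W mZ aZ eZ aW eW} aY : agree [:: rj; dif; rm; rD; ridx; ri; ru] Y X.
  by agrees.
step ltac:(rewrite (env0 eX) addn0).
set W := upd _ _ _; have aW : agree [:: rrow] W Y by rewrite /W; agrees.
have eW := env_agree eY aW erefl.
apply: wp_Seq; apply: (wp_vertex_loop z_ge kz nz cz eW).
  by rewrite /W; reads.
move=> Z t4 aZ mZ let4; have eZ := env_agree eW aZ erefl.
set cls := red_clauses k n N M tab in HQ *.
have {}mZ : Z rm = size cls.
  by rewrite mZ; reads; rewrite mY /cls !size_cat size_nseq addnA.
have {Y W aY eY mY aW eW}aZ : agree work Z X by agrees.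
do 3!step ltac:(envs eX).
step ltac:(rewrite XNI (env0 eX) addn0).
apply: wp_Seq; apply: (wp_lits_loop (b := k * n.+1) (l := size cls)) => //.
- by reads; envs eX.
- by reads; envs eX.
move=> Y t5 aY idxY let5.
do 2!step ltac:(envs eX).
apply: wp_write_nat => //; [by reads; envs eX | by reads; envs eX | ].
move=> X' t6 _ let6; move: (HQ X' t6).
rewrite letters_cnf_circuit !clauses_letters_cat -!catA /=.
rewrite idxY in let6 *; apply.
have m_le : size cls <= z ^ 3 by apply: size_red_clauses.
have NI_le : k * n.+1 <= z ^ 2 by rewrite expnS expn1; apply: leq_mul.
have s_le : k * n.+1 + size cls <= z ^ 4.
  by apply: pow_absorb => //; have := pw 2 3 erefl; lia.
have : 100 <= z ^ 4 by apply: leq_trans z_ge _; rewrite -{1}[z]expn1; apply: pw.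
have : 4 * (k * n.+1 + size cls) + 9 <= z ^ 5.
  by apply: pow_absorb => //; have := expn_gt0 z 4; lia.
move/(leq_mul m_le); rewrite -expnD => le8 ge4.
have := pw 2 14 erefl; have := pw 4 14 erefl; have := pw 6 14 erefl.
have := pw 8 14 erefl.
have : 50 * z ^ 14 <= z ^ 15 by apply: pow_absorb.
have := pw 15 16 erefl; lia.
Qed.

Lemma wp_Read i (Q : assertion) X inp out t :
  Q (upd X i (head 0 inp)) (behead inp) out t.+1 -> wp (Read i) Q X inp out t.
Proof. by []. Qed.

Lemma wp_Loop n c x (Q : assertion) X inp out t :
  wp_loop (wp c) x Q n X inp out t -> wp (Loop c x) Q X inp out t.
Proof. by move=> H; exists n. Qed.

Lemma wp_loopS n c x (Q : assertion) X inp out t :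
  wp c (fun X inp out t => if 0 < X x then wp_loop (wp c) x Q n X inp out t.+1
                           else Q X inp out t.+1) X inp out t ->
  wp_loop (wp c) x Q n.+1 X inp out t.
Proof. by []. Qed.

Local Notation rp := 24 (only parsing).
Local Notation rx := 25 (only parsing).

(** The loop stores before it reads: it starts with one letter [x] in hand and stops at the 0 that
    marks the end of the tape, letters being positive. Since [p] is at least 100, storing does not
    disturb the working registers. *)
Lemma wp_read_loop s x p (Q : assertion) X out t :
  X one = 1 -> X rx = x -> X rp = p -> 100 <= p -> all (leq 1) s ->
  (forall X' t', (forall r, r < p -> r \notin [:: rp; rx] -> X' r = X r) ->
     (forall i, i <= size s -> X' (p + i) = nth 0 (x :: s) i) ->
     X' rp = p + (size s).+1 -> t' <= t + 4 * (size s).+1 -> Q X' [::] out t') ->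
  wp (Loop (Store rp rx;; Add rp rp one;; Read rx) rx) Q X s out t.
Proof.
move=> X1 Xx Xp p_ge s_gt HQ; apply: (wp_Loop (n := (size s).+1)).
elim: s x p X t X1 Xx Xp p_ge s_gt HQ => [|y s IH] x p X t X1 Xx Xp p_ge s_gt HQ.
- have updp Y v : (upd Y p v rp = Y rp) * (upd Y p v one = Y one).
    by rewrite !updN //; lia.
  apply: wp_loopS.
  step ltac:(rewrite ?Xp ?Xx).
  step ltac:(rewrite !updp Xp X1).
  apply: wp_Read; rewrite updE /=; apply: HQ; rewrite /=; last lia.
  + by move=> r r_lt; rewrite !inE negb_or => /andP[? ?]; rewrite !updN //; lia.
  + by move=> i; rewrite leqn0 => /eqP->; rewrite addn0 updH // updH // updE /=.
  + by reads.
- have updp Y v : (upd Y p v rp = Y rp) * (upd Y p v one = Y one).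
    by rewrite !updN //; lia.
  apply: wp_loopS.
  step ltac:(rewrite ?Xp ?Xx).
  step ltac:(rewrite !updp Xp X1).
  apply: wp_Read; rewrite updE; case/andP: (s_gt) => y_gt s_gt'.
  rewrite [head 0 _]/= [behead _]/= y_gt.
  apply: (IH y (p + 1)) => //; try (by reads; rewrite ?updN ?pX //; lia).
  move=> X' t' low hi rpX' let'; apply: HQ.
  + move=> r r_lt rV; rewrite low ?rV //; last lia.
    by move: rV; rewrite !inE negb_or => /andP[? ?]; rewrite !updN //; lia.
  + case=> [_|i /hi]; last by rewrite addn1 addSnnS.
    rewrite addn0 low ?addn1 //; last by rewrite !inE; lia.
    by rewrite updH // updH // updE.
  + by rewrite rpX' [size (y :: s)]/=; lia.
  + by move: let'; rewrite /=; lia.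
Qed.

(** * Reading the graph *)

Fixpoint sqrt_up (N j : nat) : nat :=
  if j is j'.+1 then
    let r := sqrt_up N j' in if r * r < N then r.+1 else r
  else 0.

(** In each round the root grows unless its square already reaches [N]. So after [N] rounds it is at
    least [N], or its square is; and [r <= r * r]. *)
Lemma sqrt_upP N : N <= sqrt_up N N * sqrt_up N N /\
  (forall m, m < sqrt_up N N -> m * m < N).
Proof.
suff H j : (j <= sqrt_up N j \/ N <= sqrt_up N j * sqrt_up N j) /\
    (forall m, m < sqrt_up N j -> m * m < N).
  have [[le|le] H2] := H N; split=> //; apply: leq_trans le _.
  by case: (sqrt_up N N) => // r; rewrite leq_pmulr.
elim: j => [|j [IH1 IH2]] /=; first by split; [left | ].
case: (ltnP (sqrt_up N j * sqrt_up N j) N) => lt; split;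
  [|move=> m le_m|by right|exact: IH2].
  by left; case: IH1 => //; rewrite leqNgt lt.
by apply: leq_ltn_trans lt; apply: leq_mul.
Qed.

(** The first test skips the storing loop for the empty word. Squares are updated by
    [r * r + r + r + 1], and [k * n.+1] and [3 ^ k] arise by repeated addition. *)
Definition load : cmd := locked (
  Add rp rmat zero;; Read rx;; Sub rD one rx;;
  Unless rD (Loop (Store rp rx;; Add rp rp one;; Read rx) rx);;
  Sub rN rp rmat;; Const rn 0;; Const rnn 0;;
  For ri rN (Sub rD rN rnn;; Sub rD one rD;;
             Unless rD (Add rnn rnn rn;; Add rnn rnn rn;; Add rnn rnn one;;
                        Add rn rn one));;
  Add rn1 rn one;; Const rNI 0;; For ri rk (Add rNI rNI rn1);;
  Const rCC 1;; For ri rk (Add rD rCC rCC;; Add rCC rCC rD)).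

Lemma wp_load z k w tab (Q : assertion) X out t :
  100 <= z -> k <= z -> size w < z ->
  X one = 1 -> X two = 2 -> X zero = 0 -> X rk = k ->
  100 <= X rtab -> X rmat = X rtab + k.*2.+2 ->
  (forall a, a < k.*2.+2 -> X (X rtab + a) = tab a) ->
  (forall n M X' t', env k n M tab X' ->
     X' rN = size w -> X' rnn = n * n -> X' rNI = k * n.+1 ->
     (forall i, i < size w -> M i = (nth false w i).+1) ->
     size w <= n * n -> (forall m, m < n -> m * m < size w) ->
     t' <= t + z ^ 2 -> Q X' [::] out t') ->
  wp load Q X (letters w) out t.
Proof.
move=> z_ge kz wz X1 X2 X0 Xk tab_ge mat_eq tabX HQ; rewrite /load -lock.
step ltac:(rewrite X0 addn0).
set W := upd _ _ _.
have aW : agree [:: rp] W X by rewrite /W; agrees.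
apply: wp_Seq.
pose P : assertion := fun X' inp out' t' =>
  [/\ forall r, r < X rmat -> r \notin [:: rp; rx; rD] -> X' r = X r,
      forall i, i < size w -> X' (X rmat + i) = (nth false w i).+1,
      X' rp = X rmat + size w, inp = [::] &
      out' = out /\ t' <= t + 4 * size w + 5].
apply: wp_Read; step ltac:(rewrite ?X1).
apply: wp_Seq; apply: (@wp_mono _ P); last first.
  apply: wp_Unless; reads.
    case Dw: w => [|b s] /=; last by case: b {Dw}.
    move=> _; rewrite /P Dw; split=> //; last by rewrite addn0; split=> //; lia.
      by move=> r _; rewrite !inE !negb_or => /and3P[? ? ?]; rewrite /W !updN.
    by reads; rewrite addn0.
  case Dw: w => [|b s] //= _.
  have lowW Y : agree [:: rx; rD] Y W ->
      forall r, r \notin [:: rp; rx; rD] -> Y r = X r.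
    move=> aY r; rewrite !inE !negb_or => /and3P[? ? ?].
    by rewrite aY ?inE ?negb_or ?aW // ?inE //; apply/andP.
  apply: (wp_read_loop (x := (nth false w 0).+1) (p := X rmat)).
  - by reads.
  - by reads; rewrite Dw.
  - by rewrite /W; reads.
  - lia.
  - by elim: (s) => //= ? ? ->.
  move=> Y t1 low hi rpY let1; split=> //.
  - move=> r lt_r r_n; rewrite low //; first by apply: lowW => //; agrees.
    by move: r_n; rewrite !inE !negb_or => /and3P[-> ->].
  - rewrite Dw => i lt_i; rewrite hi ?size_map // Dw /=.
    by case: i lt_i => //= i lt_i; rewrite (nth_map false).
  - by rewrite rpY size_map Dw.
  - by move: let1; rewrite size_map Dw /=; split=> //; lia.
move=> Y inp out1 t1 [low hi rpY -> [-> let1]].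
have Y_ r : r < 100 -> r \notin [:: rp; rx; rD] -> Y r = X r.
  by move=> *; apply: low => //; lia.
step ltac:(rewrite rpY (Y_ rmat erefl erefl) addKn).
do 2!step idtac.
set N := size w in HQ let1 wz rpY hi *.
set U := upd (upd _ _ _) _ _.
have aU : agree [:: rnn; rn; rN] U Y by rewrite /U; agrees.
have U_ r : r < 100 -> r \notin [:: rp; rx; rD; rnn; rn; rN] -> U r = X r.
  move=> r_lt; rewrite !inE !negb_or => /and5P[? ? ? ? /andP[? ?]].
  by rewrite aU ?Y_ // !inE !negb_or; apply/and3P.
have UN : U rN = N by rewrite /U; reads.
have Un : U rn = 0 by rewrite /U; reads.
have Unn : U rnn = 0 by rewrite /U; reads.
have UH a : 100 <= a -> U a = Y a by exact: agreeH aU erefl.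
clearbody U; clear aU aW.
apply: wp_Seq; apply: (wp_for_frame (V := [:: rnn; rn; rD; ri; dif])
  (acc := [:: (rn, sqrt_up N); (rnn, fun j => sqrt_up N j * sqrt_up N j)])
  (F := fun=> [::]) (B := 10)) => //.
- by rewrite U_.
- move=> j Z out2 t2 _ aZ [nZ [nnZ _]] Zj.
  step ltac:(rewrite UN nnZ).
  step ltac:(rewrite (U_ one erefl erefl) X1).
  apply: wp_Unless; reads; rewrite [(_, _).2 j]/= => hD.
    split; [by agrees | by reads | | by [] | by rewrite cats0; split=> //; lia].
    rewrite /=; reads; rewrite nZ nnZ /= ifN //; lia.
  step ltac:(rewrite nZ nnZ /=).
  step ltac:(rewrite nZ /=).
  step ltac:(rewrite (U_ one erefl erefl) X1).
  step ltac:(rewrite nZ (U_ one erefl erefl) X1 /=).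
  split; [by agrees | by reads | | by [] | by rewrite cats0; split=> //; lia].
  by rewrite /=; reads; rewrite ifT; last lia; repeat split; lia.
rewrite UN => Z t2 aZ [nZ [nnZ _]] let2.
rewrite (_ : flatten _ = [::]) ?cats0; last by elim: (iota _ _).
set n := sqrt_up N N in nZ nnZ.
have {}nZ : Z rn = n by []; have {}nnZ : Z rnn = n * n by [].
have U1 : U one = 1 by rewrite U_.
step ltac:(rewrite nZ U1).
step idtac.
set V := upd (upd _ _ _) _ _.
have aV : agree [:: rNI; rn1] V Z by rewrite /V; agrees.
have Vk : V rk = k by rewrite /V; reads; rewrite U_.
have Vn1 : V rn1 = n.+1 by rewrite /V; reads; rewrite addn1.
apply: wp_Seq; apply: (wp_for_frame (V := [:: rNI; ri; dif])
  (acc := [:: (rNI, fun j => j * n.+1)]) (F := fun=> [::]) (B := 1)) => //.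
- by reads.
- move=> j Y' out2 t3 _ aY' [NIY' _] Y'j.
  step ltac:(rewrite NIY' Vn1 /=).
  split; [by agrees | by reads | | by [] | by rewrite cats0; split=> //; lia].
  by rewrite /=; reads; rewrite mulSn addnC.
rewrite Vk => Z' t3 aZ' [NIZ' _] let3.
rewrite (_ : flatten _ = [::]) ?cats0; last by elim: (iota _ _).
step idtac.
set V' := upd _ _ _.
have aV' : agree [:: rCC] V' Z' by rewrite /V'; agrees.
apply: (wp_for_frame (V := [:: rCC; rD; ri; dif])
  (acc := [:: (rCC, fun j => 3 ^ j)]) (F := fun=> [::]) (B := 2)) => //.
- by reads.
- move=> j Y' out2 t4 _ aY' [CCY' _] Y'j.
  step ltac:(rewrite CCY').
  step ltac:(rewrite CCY' /=).
  split; [by agrees | by reads | | by [] | by rewrite cats0; split=> //; lia].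
  by rewrite /=; reads; rewrite expnS; split=> //; lia.
move=> X' t4 aX' [CCX' _] let4.
rewrite (_ : flatten _ = [::]) ?cats0; last by elim: (iota _ _).
have [N_le n_min] := sqrt_upP N.
have V'k : V' rk = k by reads; rewrite U_.
rewrite V'k in CCX' let4.
have X'H a : 100 <= a -> X' a = Y a.
  move=> a_ge; rewrite (agreeH aX') // (agreeH aV') // (agreeH aZ') //.
  by rewrite (agreeH aV) // (agreeH aZ) // UH.
have X'mat : X' rmat = X rmat by reads; rewrite U_.
(* [M] is read off the final memory. Behind the word there may be remains of simulations; as matrix
   entries they matter only when the length is not a square, and then the empty clause decides. *)
apply: (HQ n (fun a => X' (X' rmat + a))) => //.
- split=> //; try by [reads; rewrite ?U_].
  + move=> a lt_a; have -> : X' rtab = X rtab by reads; rewrite U_.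
    by rewrite X'H ?low ?tabX // ?inE; lia.
  + by rewrite X'mat; lia.
- by reads.
- by reads.
- by reads; rewrite NIZ'.
- by move=> i lt_i; rewrite X'mat X'H ?hi //; lia.
- have n_le : 50 * z <= z ^ 2 by apply: pow_absorb; rewrite // expn1.
  lia.
Qed.

(** * Simulating the machines for [sigma] and [rho] *)

Local Notation rbase := 30 (only parsing).
Local Notation rtop := 31 (only parsing).
Local Notation rpc := 32 (only parsing).
Local Notation rin := 33 (only parsing).
Local Notation rout := 34 (only parsing).
Local Notation rst := 35 (only parsing).
Local Notation rcur := 36 (only parsing).
Local Notation rrun := 37 (only parsing).
Local Notation rV := 38 (only parsing).
Local Notation rB := 39 (only parsing).

Definition get (r j : nat) : cmd := Const rA j;; Add rA rbase rA;; Fetch r rA.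

(** Adding the truncated [rA + 1 - rtop] to [rtop] gives the maximum of [rtop] and [rA + 1], so that
    everything from [rtop] on stays untouched. *)
Definition put : cmd :=
  Store rA rV;; Add rA rA one;; Sub rA rA rtop;; Add rtop rtop rA;;
  Add rpc rpc one.

Definition addr (i : nat) : cmd := Const rA i;; Add rA rbase rA.

(** The simulated program is fixed, so its operands are constants of the simulating code. [Read]
    leaves an exhausted input behind, and [Write] merely replaces [rout], because one number is read
    and one is output. *)
Definition sim_instr (i : instr) : cmd :=
  match i with
  | Const i c => Const rV c;; addr i;; put
  | Add i j l => get rV j;; get rB l;; Add rV rV rB;; addr i;; put
  | Sub i j l => get rV j;; get rB l;; Sub rV rV rB;; addr i;; put
  | Fetch i j => get rV j;; Add rA rbase rV;; Fetch rV rA;; addr i;; put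
  | Store i j => get rV j;; get rB i;; Add rA rbase rB;; put
  | Jump j l => get rB j;; Add rpc rpc one;; Sub rD one rB;;
                Unless rD (Const rpc l)
  | Read i => Add rV rin zero;; Const rin 0;; addr i;; put
  | Write i => get rout i;; Add rpc rpc one
  end.

(* [X] represents the configuration [c] of a simulated machine whose input tape
   holds at most one number and of whose output only the last number is kept.
   Its registers are stored from address [b] on; all addresses from [X rtop]
   on still contain 0, so that the next simulation may use them. *)
Record sim (b : nat) (X : nat -> nat) (c : config) : Prop := Sim {
  sim1 : X one = 1;
  sim0 : X zero = 0;
  sim_base : X rbase = b;
  sim_ge : 100 <= b;
  sim_top : b <= X rtop;
  sim_reg : forall r, X (b + r) = reg c r;
  sim_fresh : forall a, X rtop <= a -> X a = 0;
  sim_pc : X rpc = pc c;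
  sim_in : X rin = head 0 (input c);
  sim_behead : behead (input c) = [::];
  sim_out : X rout = last 0 (output c) }.

Lemma sim_change V b X Y q R ip op q' ip' op' :
  sim b X (Config q R ip op) -> agree V Y X ->
  all (fun r => (r < 100) && (r \notin [:: one; zero; rbase; rtop])) V ->
  Y rpc = q' -> Y rin = head 0 ip' -> behead ip' = [::] ->
  Y rout = last 0 op' -> sim b Y (Config q' R ip' op').
Proof.
move=> S aY; rewrite all_predI => /andP[V100 /allP Vd] Ypc Yin ipE Yout.
have E r : r \in [:: one; zero; rbase; rtop] -> Y r = X r.
  by move=> rE; apply: aY; apply/negP => /Vd; rewrite rE.
case: S => *; split; try first [assumption | by rewrite E].
- by move=> a; rewrite (agreeH aY) //; lia.
- by rewrite E // => a *; rewrite (agreeH aY) //; [auto | lia].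
Qed.

Lemma sim_agree V b X Y c : sim b X c -> agree V Y X ->
  all (fun r => (r < 100) &&
    (r \notin [:: one; zero; rbase; rtop; rpc; rin; rout])) V ->
  sim b Y c.
Proof.
case: c => q R ip op S aY Vd; apply: (sim_change S aY).
- by apply: sub_all Vd => r; rewrite !inE !negb_or; lia.
- by rewrite aY ?(sim_pc S) //; apply/negP => /(allP Vd).
- by rewrite aY ?(sim_in S) //; apply/negP => /(allP Vd).
- exact: sim_behead S.
- by rewrite aY ?(sim_out S) //; apply/negP => /(allP Vd).
Qed.

Definition sim_work := [:: rA; rD; rV; rB; rtop; rpc; rin; rout].

(** From its base [b] on a simulation may write anywhere, so its frame condition concerns only the
    addresses below. *)
Definition low_agree (b : nat) (V : seq nat) (X Y : nat -> nat) :=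
  forall r, r < b -> r \notin V -> X r = Y r.

Lemma agree_low b V W X Y : agree V X Y -> all (mem W) V -> low_agree b W X Y.
Proof.
move=> XY /allP VW r _ rW; apply: XY; by apply: contra rW => /VW.
Qed.

Lemma low_agree_trans b V X Y Z :
  low_agree b V X Y -> low_agree b V Y Z -> low_agree b V X Z.
Proof. by move=> XY YZ r rb rV; rewrite XY ?YZ. Qed.

Lemma wp_get r j b R q ip op (Q : assertion) X inp out t :
  sim b X (Config q R ip op) ->
  (forall X', agree [:: r; rA] X' X -> X' r = R j -> Q X' inp out t.+3) ->
  wp (get r j) Q X inp out t.
Proof.
move=> S HQ; rewrite /get; have b_ge := sim_ge S.
step idtac.
step ltac:(rewrite (sim_base S)).
step ltac:(rewrite 2?updH ?(sim_reg S) //; try lia).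
apply: HQ; last by rewrite updE.
by do 3!(apply: agree_upd; first by rewrite !inE eqxx ?orbT).
Qed.

Lemma wp_put b R q ip op r v (Q : assertion) X inp out t :
  sim b X (Config q R ip op) -> X rA = b + r -> X rV = v ->
  (forall X', sim b X' (Config q.+1 (upd R r v) ip op) ->
     low_agree b sim_work X' X -> Q X' inp out t.+4.+1) ->
  wp put Q X inp out t.
Proof.
move=> S XA XV HQ; rewrite /put; have b_ge := sim_ge S.
have E Y s w : s < 100 -> upd Y (b + r) w s = Y s.
  by move=> ?; rewrite updN //; lia.
step ltac:(rewrite ?XA ?XV).
step ltac:(rewrite E; [rewrite E; [rewrite XA (sim1 S) | by []] | by []]).
step ltac:(rewrite E; [ | by []]).
step ltac:(rewrite E; [ | by []]).
step ltac:(rewrite E;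
  [rewrite E; [rewrite (sim_pc S) (sim1 S) | by []] | by []]).
rewrite addn1 [pc _]/=.
have Ehi Y s w a : s < 100 -> b <= a -> upd Y s w a = Y a.
  by move=> ? ?; rewrite updN //; lia.
have top_ge := sim_top S.
apply: HQ.
- split; rewrite ?updE //; try (by reads; rewrite E // ?(sim1 S) ?(sim0 S)
      ?(sim_base S) ?(sim_in S) ?(sim_out S) ?(sim_behead S)).
  + by reads; lia.
  + move=> a; do 4!(rewrite Ehi; [ | by [] | exact: leq_addr]).
    by rewrite /upd eqn_add2l (sim_reg S).
  + reads; move=> a a_ge; do 4!(rewrite Ehi; [ | by [] | lia]).
    have a_gt : X rtop <= a /\ b + r < a by split; lia.
    by rewrite updN; [apply: (sim_fresh S); case: a_gt | lia].
  + by rewrite addn1.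
  + exact: sim_behead S.
- move=> s s_lt; rewrite !inE !negb_or => /and5P[? ? ? ? /and4P[? ? ? ?]].
  by rewrite !updN //; lia.
Qed.

(* Unification is slow when it may unfold [wp]. *)
Opaque wp.

Lemma wp_addr_put b R q ip op r v (Q : assertion) X inp out t :
  sim b X (Config q R ip op) -> X rV = v ->
  (forall X', sim b X' (Config q.+1 (upd R r v) ip op) ->
     low_agree b sim_work X' X -> Q X' inp out t.+4.+3) ->
  wp (addr r) (wp put Q) X inp out t.
Proof.
move=> S XV HQ; rewrite /addr.
step idtac.
step ltac:(rewrite (sim_base S)).
set Y := upd _ _ _; have aY : agree [:: rA] Y X by rewrite /Y; agrees.
eapply (wp_put (sim_agree S aY erefl) (r := r) (v := v)).
- by rewrite /Y updE.
- by reads.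
move=> X' S' low; apply: HQ => //.
by apply: low_agree_trans low _; exact: agree_low aY _.
Qed.

Lemma wp_sim_instr b i c (Q : assertion) X inp out t :
  sim b X c ->
  (forall X' t', sim b X' (exec i c) -> low_agree b sim_work X' X ->
     t' <= t + 14 -> Q X' inp out t') ->
  wp (sim_instr i) Q X inp out t.
Proof.
case: c => q R ip op S HQ.
have b_ge := sim_ge S.
have low V Y : agree V Y X -> all (mem sim_work) V -> low_agree b sim_work Y X.
  exact: agree_low.
have lowT Y Z : low_agree b sim_work Z Y -> low_agree b sim_work Y X ->
    low_agree b sim_work Z X by exact: low_agree_trans.
case: i HQ => [i v|i j l|i j l|i j|i j|j l|i|i] HQ; rewrite /sim_instr.
- step idtac.
  set Y := upd _ _ _; have aY : agree [:: rV] Y X by rewrite /Y; agrees.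
  eapply wp_Seq; eapply (wp_addr_put (sim_agree S aY erefl) (v := v)).
    by rewrite /Y updE.
  move=> Z SZ lowZ; apply: HQ => //; last lia.
  by apply: lowT lowZ (low _ _ aY _).
- eapply wp_Seq; eapply (wp_get S); move=> Y aY VY.
  have SY := sim_agree S aY erefl.
  eapply wp_Seq; eapply (wp_get SY); move=> Z aZ BZ.
  have SZ := sim_agree SY aZ erefl.
  step ltac:(rewrite VY BZ).
  set W := upd _ _ _; have aW : agree [:: rV; rA; rB] W X by rewrite /W; agrees.
  eapply wp_Seq; eapply (wp_addr_put (sim_agree S aW erefl)).
    by rewrite /W updE.
  move=> U SU lowU; apply: HQ => //; last lia.
  by apply: lowT lowU (low _ _ aW _).
- eapply wp_Seq; eapply (wp_get S); move=> Y aY VY.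
  have SY := sim_agree S aY erefl.
  eapply wp_Seq; eapply (wp_get SY); move=> Z aZ BZ.
  have SZ := sim_agree SY aZ erefl.
  step ltac:(rewrite VY BZ).
  set W := upd _ _ _; have aW : agree [:: rV; rA; rB] W X by rewrite /W; agrees.
  eapply wp_Seq; eapply (wp_addr_put (sim_agree S aW erefl)).
    by rewrite /W updE.
  move=> U SU lowU; apply: HQ => //; last lia.
  by apply: lowT lowU (low _ _ aW _).
- eapply wp_Seq; eapply (wp_get S); move=> Y aY VY.
  have SY := sim_agree S aY erefl.
  step ltac:(rewrite (sim_base S) VY).
  step ltac:(rewrite ?updH ?(sim_reg SY) //; try lia).
  set W := upd _ _ _; have aW : agree [:: rV; rA; rB] W X by rewrite /W; agrees.
  eapply wp_Seq; eapply (wp_addr_put (sim_agree S aW erefl)).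
    by rewrite /W updE.
  move=> U SU lowU; apply: HQ => //; last lia.
  by apply: lowT lowU (low _ _ aW _).
- eapply wp_Seq; eapply (wp_get S); move=> Y aY VY.
  have SY := sim_agree S aY erefl.
  eapply wp_Seq; eapply (wp_get SY); move=> Z aZ BZ.
  have SZ := sim_agree SY aZ erefl.
  step ltac:(rewrite (sim_base S) BZ).
  set W := upd _ _ _; have aW : agree [:: rV; rA; rB] W X by rewrite /W; agrees.
  eapply (wp_put (sim_agree S aW erefl)).
  + by rewrite /W updE.
  + by rewrite /W; reads; rewrite VY.
  move=> U SU lowU; apply: HQ => //; last lia.
  by apply: lowT lowU (low _ _ aW _).
- eapply wp_Seq; eapply (wp_get S); move=> Y aY BY.
  have SY := sim_agree S aY erefl.
  step ltac:(rewrite (sim_pc S) (sim1 S) addn1 /=).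
  step ltac:(rewrite (sim1 S) BY).
  set W := upd _ _ _; have aW : agree [:: rD; rB; rA; rpc] W X.
    by rewrite /W; agrees.
  have next Z q' t' : agree [:: rD; rB; rA; rpc] Z X -> Z rpc = q' ->
      q' = (if 0 < R j then l else q.+1) -> t' <= t + 14 -> Q Z inp out t'.
    move=> aZ Zpc q'E t'_le; apply: HQ => //; last exact: low aZ _.
    rewrite /= -q'E.
    apply: (sim_change S aZ) => //; reads.
    - exact: sim_in S.
    - exact: sim_behead S.
    - exact: sim_out S.
  apply wp_Unless; rewrite {1}/W updE => hB.
    by apply: (next _ q.+1); rewrite /W; [agrees | reads | case: ifP; lia | lia].
  step idtac.
  by apply: (next _ l); rewrite /W; [agrees | reads | case: ifP; lia | lia].
- step ltac:(rewrite (sim_in S) (sim0 S) addn0).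
  step idtac.
  set W := upd _ _ _; have aW : agree [:: rV; rin] W X by rewrite /W; agrees.
  have SW : sim b W (Config q R (behead ip) op).
    apply: (sim_change S aW) => //; reads; rewrite ?(sim_pc S) ?(sim_out S) //.
    + by rewrite /W updE (sim_behead S : behead ip = [::]).
    + by rewrite (sim_behead S : behead ip = [::]).
  eapply wp_Seq; eapply (wp_addr_put SW); first by rewrite /W; reads.
  move=> U SU lowU; apply: HQ => //; last lia.
  by apply: lowT lowU (low _ _ aW _).
- eapply wp_Seq; eapply (wp_get S); move=> Y aY VY.
  step ltac:(rewrite (sim_pc S) (sim1 S) addn1 /=).
  set W := upd _ _ _; have aW : agree [:: rout; rA; rpc] W X.
    by rewrite /W; agrees.
  apply: HQ; [ | exact: low aW _ | lia].
  apply: (sim_change S aW) => //.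
  + by reads; exact: sim_in S.
  + exact: sim_behead S.
  + by rewrite last_rcons /W; reads.
Qed.

(** In the absence of indexed jumps, the program counter is compared with each instruction number.
    The copy [rcur] is compared, since executing an instruction changes [rpc], which could then
    match a later test. *)
Fixpoint dispatch (p : program) (q : nat) : cmd :=
  if p is i :: p' then
    Const rD q;; Sub rV rcur rD;; Sub rD rD rcur;; Add rD rD rV;;
    Unless rD (sim_instr i);; dispatch p' q.+1
  else Const rA 0.

Lemma sub_low b V W X Y : low_agree b V X Y -> {subset V <= W} ->
  low_agree b W X Y.
Proof. by move=> XY VW r rb rW; apply: XY => //; apply: contra rW; exact: VW. Qed.

(** The tests that follow the executed instruction all fail. *)
Lemma wp_dispatch_skip p q b c (Q : assertion) X inp out t :
  sim b X c -> X rcur < q ->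
  (forall X' t', agree [:: rA; rD; rV] X' X -> t' <= t + 5 * size p + 1 ->
     Q X' inp out t') ->
  wp (dispatch p q) Q X inp out t.
Proof.
elim: p q X t => [|i p IH] q X t S lt_q HQ; rewrite /dispatch -/dispatch.
  by step idtac; apply: HQ; [agrees | lia].
step idtac.
do 3!step idtac.
set W := upd _ _ _; have aW : agree [:: rA; rD; rV] W X by rewrite /W; agrees.
eapply wp_Seq; eapply wp_Unless; rewrite {1}/W updE => hD; last by lia.
apply: IH (sim_agree S aW erefl) _ _; first by reads; lia.
by move=> X' t' aX' le_t'; apply: HQ; [agrees | rewrite /=; lia].
Qed.

Lemma wp_dispatch p q m b c (Q : assertion) X inp out t :
  sim b X c -> X rcur = q + m -> m < size p ->
  (forall X' t', sim b X' (exec (nth (Const 0 0) p m) c) ->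
     low_agree b sim_work X' X -> t' <= t + 5 * size p + 20 -> Q X' inp out t') ->
  wp (dispatch p q) Q X inp out t.
Proof.
elim: p q m X t => // i p IH q m X t S cur lt_m HQ.
rewrite /dispatch -/dispatch.
step idtac.
do 3!step idtac.
set W := upd _ _ _; have aW : agree [:: rA; rD; rV] W X by rewrite /W; agrees.
have SW := sim_agree S aW erefl; have b_ge := sim_ge S.
have lowW : low_agree b sim_work W X by exact: agree_low aW _.
eapply wp_Seq; eapply wp_Unless; rewrite {1}/W updE cur => hD.
- case: m lt_m cur hD HQ => [|m] lt_m cur hD HQ; first by lia.
  apply: (IH q.+1 m _ _ SW) => //; first by reads; lia.
  move=> X' t' SX' lowX' le_t'; apply: HQ => //; last by rewrite /=; lia.
  exact: low_agree_trans lowX' lowW.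
- have m0 : m = 0 by lia.
  eapply (wp_sim_instr SW) => Y t1 SY lowY le1.
  have cY : Y rcur = q.
    by rewrite lowY //; [reads; rewrite cur m0 addn0 | lia].
  eapply (wp_dispatch_skip SY); first by rewrite cY.
  move=> X' t' aX' le_t'; apply: HQ; last by rewrite /=; lia.
    by rewrite m0; exact: sim_agree SY aX' _.
  apply: low_agree_trans (agree_low aX' _) _ => //.
  exact: low_agree_trans lowY lowW.
Qed.

(** [rrun] is positive exactly while the simulated machine has not halted; [rst] is never reset, and
    so adds up the steps of all simulations. *)
Definition sim_step (p : program) : cmd :=
  Add rst rst one;; Add rcur rpc zero;; dispatch p 0;;
  Const rA (size p);; Sub rrun rA rpc.

Definition all_work := [:: rst, rcur, rrun, rbase & sim_work].

Lemma wp_sim_step p b c (Q : assertion) X inp out t :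
  sim b X c -> ~~ halted p c ->
  (forall X' t', sim b X' (step p c) -> X' rst = X rst + 1 ->
     X' rrun = size p - pc (step p c) -> low_agree b all_work X' X ->
     t' <= t + 5 * size p + 24 -> Q X' inp out t') ->
  wp (sim_step p) Q X inp out t.
Proof.
move=> S; rewrite /halted -ltnNge => lt_pc HQ.
rewrite /sim_step. step ltac:(rewrite (sim1 S)).
step ltac:(rewrite (sim_pc S) (sim0 S) addn0).
set W := upd _ _ _; have aW : agree [:: rst; rcur] W X by rewrite /W; agrees.
have SW := sim_agree S aW erefl; have b_ge := sim_ge S.
eapply wp_Seq; eapply (wp_dispatch (q := 0) (m := pc c) SW);
  [by rewrite /W; reads | by [] | move=> Y t1 SY lowY le1].
have {}SY : sim b Y (step p c) by move: SY; rewrite /step /halted leqNgt lt_pc.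
step idtac.
step ltac:(rewrite (sim_pc SY)).
set Z := upd _ _ _; have aZ : agree [:: rA; rrun] Z Y by rewrite /Z; agrees.
apply: HQ; [exact: sim_agree SY aZ _ | | by rewrite /Z updE | | lia].
  by reads; rewrite lowY //; lia.
apply: low_agree_trans (agree_low aZ _) _ => //.
apply: low_agree_trans (sub_low lowY _) (agree_low aW _) => // r.
by move=> rV; rewrite /all_work 4!in_cons rV !orbT.
Qed.

Definition sim_loop (p : program) : cmd := Loop (sim_step p) rrun.

(** [T.+1] is the first time at which the machine has halted, so [rst] grows by exactly this number;
    it is a successor because [Loop] runs its body at least once. *)
Lemma wp_sim_loop p b c T (Q : assertion) X inp out t :
  sim b X c -> halted p (iter T.+1 (step p) c) ->
  (forall T', T' <= T -> ~~ halted p (iter T' (step p) c)) ->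
  (forall X' t', sim b X' (iter T.+1 (step p) c) -> X' rst = X rst + T.+1 ->
     low_agree b all_work X' X -> t' <= t + T.+1 * (5 * size p + 25) ->
     Q X' inp out t') ->
  wp (sim_loop p) Q X inp out t.
Proof.
move=> S hT nhT HQ; apply: (wp_Loop (n := T.+1)).
elim: T c X t S hT nhT HQ => [|T IH] c X t S hT nhT HQ; eapply wp_loopS.
- eapply (wp_sim_step S (nhT 0 erefl)) => Y t1 SY stY runY lowY le1.
  move: hT; rewrite runY subn_gt0 /= /halted leqNgt => /negPf->.
  by apply: HQ => //; lia.
- eapply (wp_sim_step S (nhT 0 erefl)) => Y t1 SY stY runY lowY le1.
  have := nhT 1 erefl; rewrite runY subn_gt0 /= /halted -ltnNge => ->.
  rewrite iterSr in hT; apply: (IH _ _ _ SY hT).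
    by move=> T' le_T; rewrite -iterSr; apply: nhT.
  move=> X' t' SX' stX' lowX' le2; apply: HQ.
  + by rewrite iterSr.
  + by rewrite stX' stY; lia.
  + exact: low_agree_trans lowX' lowY.
  + rewrite mulSn; lia.
Qed.

(** The base is moved to [rtop], beyond all cells written so far, so the simulated registers are 0
    without any clearing. *)
Definition sim_run (p : program) (j : nat) : cmd := locked (
  Add rbase rtop zero;; Const rpc 0;; Add rin j zero;; Const rout 0;; sim_loop p).

Definition fresh (X : nat -> nat) := forall a, X rtop <= a -> X a = 0.

Lemma wp_sim_run p j m v T (Q : assertion) X inp out t :
  X one = 1 -> X zero = 0 -> 100 <= X rtop -> fresh X -> X j = m ->
  j \notin [:: rbase; rpc] ->
  outputs_in p [:: m] [:: v] T ->
  (forall T', T' < T -> ~~ halted p (run p [:: m] T')) ->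
  (forall X' t', fresh X' -> X rtop <= X' rtop -> X' rout = v ->
     X' rst = X rst + T -> low_agree (X rtop) all_work X' X ->
     t' <= t + T * (5 * size p + 25) + 4 -> Q X' inp out t') ->
  wp (sim_run p j) Q X inp out t.
Proof.
move=> X1 X0 top_ge fX Xj; rewrite !inE negb_or => /andP[jb jp].
rewrite /outputs_in /run; set c := Config _ _ _ _ => -[hT oT] nhT HQ.
rewrite /sim_run -lock.
(* A machine that takes no step has no output, but [p] outputs [v]. *)
case: T => [|T] in hT oT nhT HQ *; first by move: oT.
step ltac:(rewrite X0 addn0).
step idtac.
step ltac:(rewrite (updN _ _ jp) (updN _ _ jb) Xj X0 addn0).
step idtac.
set W := upd _ _ _.
have aW : agree [:: rbase; rpc; rin; rout] W X by rewrite /W; agrees.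
have SW : sim (X rtop) W c.
  split; rewrite /c //=; try by [reads | rewrite /W; reads].
  - by move=> r; rewrite (agreeH aW) //; [apply: fX | ]; lia.
  - by reads; move=> a le_a; rewrite (agreeH aW) //; [apply: fX | ]; lia.
eapply (wp_sim_loop SW hT nhT) => Y t1 SY stY lowY le1.
apply: HQ.
- exact: sim_fresh SY.
- exact: sim_top SY.
- by rewrite (sim_out SY) oT.
- by rewrite stY; reads.
- by apply: low_agree_trans lowY (agree_low aW _).
- lia.
Qed.

(** * The table of allowed numbers of neighbours *)

(** [tau n] is the exact halting time and not just a bound, so that the step counter ends with the
    same value in the reduction and in the program computing its time bound. *)
Definition decides_in (A : {pred nat}) (p : program) (tau : nat -> nat) : Prop :=
  forall n, outputs_in p [:: n] [:: nat_of_bool (n \in A)] (tau n) /\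
    (forall T, T < tau n -> ~~ halted p (run p [:: n] T)).

(** Whether a machine has halted is a boolean, so the least halting time exists constructively; the
    configuration is stationary from then on, so the output is already final. *)
Lemma recursive_set_decides A :
  recursive_set A -> exists p tau, decides_in A p tau.
Proof.
case=> p out_p; exists p.
have hal n : exists T, halted p (run p [:: n] T).
  by have [T [hT _]] := out_p n; exists T.
exists (fun n => ex_minn (hal n)) => n.
case: ex_minnP => T hT minT; split; last first.
  by move=> T' lt_T'; apply/negP => /minT; rewrite leqNgt lt_T'.
have [T1 [hT1 oT1]] := out_p n; split=> //; rewrite -oT1.
have stop m : iter m (step p) (run p [:: n] T) = run p [:: n] T.
  by elim: m => //= m ->; rewrite /step hT.
rewrite -(stop (T1 - T)) -[in LHS]/(run _ _ _) /run -iterD subnK //.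
exact: minT.
Qed.

Definition table_entry (p : program) : cmd :=
  sim_run p rv;; Store rp rout;; Add rp rp one.

(** Numbers up to [k] suffice, for a set of at most [k] vertices. The simulations start at the
    address reserved for the matrix, which is read in only afterwards. *)
Definition tables (ps pr : program) : cmd := locked (
  Read rk;; Const one 1;; Const two 2;; Const rtab 100;;
  Add rmat rk rk;; Add rmat rmat two;; Add rmat rmat rtab;;
  Add rtop rmat zero;; Add rp rtab zero;; Add rn1 rk one;;
  For rv rn1 (table_entry pr;; table_entry ps)).

Definition table (sigma rho : {pred nat}) (a : nat) : nat :=
  if odd a then a./2 \in sigma else a./2 \in rho.

Definition total_steps (taus taur : nat -> nat) (j : nat) : nat :=
  sumn [seq taur i + taus i | i <- iota 0 j].

Lemma total_stepsS taus taur j :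
  total_steps taus taur j.+1 = total_steps taus taur j + (taur j + taus j).
Proof. by rewrite /total_steps -addn1 iotaD map_cat sumn_cat /= addn0. Qed.

Record tables_inv (tab : nat -> nat) (k m st : nat) (X : nat -> nat) : Prop := {
  inv1 : X one = 1;
  inv2 : X two = 2;
  inv0 : X zero = 0;
  inv_k : X rk = k;
  inv_tab : X rtab = 100;
  inv_mat : X rmat = 100 + k.*2.+2;
  inv_top : X rmat <= X rtop;
  inv_fresh : fresh X;
  inv_p : X rp = 100 + m;
  inv_entries : forall a, a < m -> X (100 + a) = tab a;
  inv_st : X rst = st }.

Lemma tables_inv_agree V tab k m st X Y : tables_inv tab k m st X -> agree V Y X ->
  all (fun r => (r < 100) &&
    (r \notin [:: one; two; zero; rk; rtab; rmat; rtop; rp; rst])) V ->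
  tables_inv tab k m st Y.
Proof.
move=> I aY; rewrite all_predI => /andP[V100 /allP Vd].
have E r : r \in [:: one; two; zero; rk; rtab; rmat; rtop; rp; rst] -> Y r = X r.
  by move=> rE; apply: aY; apply/negP => /Vd; rewrite rE.
case: I => *; split; try by [rewrite ?E].
- by move=> a; rewrite E // => *; rewrite (agreeH aY) //; first [lia | auto].
- by move=> a *; rewrite (agreeH aY) //; first [lia | auto].
Qed.

Lemma wp_table_entry A p tau tab k m st v (Q : assertion) X inp out t :
  decides_in A p tau -> tables_inv tab k m st X -> m < k.*2.+2 -> X rv = v ->
  tab m = nat_of_bool (v \in A) ->
  (forall X' t', tables_inv tab k m.+1 (st + tau v) X' -> X' rv = v ->
     X' rn1 = X rn1 -> t' <= t + tau v * (5 * size p + 25) + 6 ->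
     Q X' inp out t') ->
  wp (table_entry p) Q X inp out t.
Proof.
move=> dec I lt_m Xv tabm HQ; rewrite /table_entry; have [outp minp] := dec v.
have top_gt : 100 + k.*2.+2 <= X rtop by rewrite -(inv_mat I) (inv_top I).
have top_ge : 100 <= X rtop by lia.
eapply wp_Seq.
eapply (wp_sim_run (inv1 I) (inv0 I) top_ge (inv_fresh I) Xv erefl outp minp).
move=> Y t1 fY topY outY stY lowY le1.
have Y_ r : r < 100 -> r \notin all_work -> Y r = X r.
  by move=> *; apply: lowY => //; lia.
step ltac:(rewrite ?outY ?(Y_ rp erefl erefl) ?(inv_p I)).
have hi W w r : r < 100 -> upd W (100 + m) w r = W r.
  by move=> ?; rewrite updN //; lia.
step ltac:(rewrite (Y_ rp erefl erefl) (Y_ one erefl erefl) (inv_p I) (inv1 I)).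
set Z := upd _ _ _.
have Z_ r : r < 100 -> r != rp -> Z r = Y r by move=> ? ?; rewrite /Z updN // hi.
apply: HQ; last lia; rewrite ?Z_ ?Y_ //.
split; try by [rewrite Z_ // Y_ //; case: I].
- by rewrite !Z_ // (Y_ rmat) //; exact: leq_trans (inv_top I) topY.
- by rewrite /fresh Z_ // => a le_a; rewrite /Z !updN; [apply: fY | |]; lia.
- by rewrite /Z updE addn1 addnS.
- move=> a; rewrite ltnS leq_eqVlt => /predU1P[->|lt_a].
    by rewrite /Z updN ?updE ?tabm //; lia.
  by rewrite /Z !updN ?lowY ?(inv_entries I) //; rewrite ?inE; lia.
- by rewrite Z_ // stY (inv_st I).
Qed.

Definition cost_unit (ps pr : program) : nat := 5 * (size ps + size pr) + 25.

Lemma wp_tables sigma rho ps pr taus taur k rest (Q : assertion) :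
  decides_in sigma ps taus -> decides_in rho pr taur ->
  (forall X t,
     tables_inv (table sigma rho) k k.*2.+2 (total_steps taus taur k.+1) X ->
     t <= total_steps taus taur k.+1 * cost_unit ps pr + 15 * k + 28 ->
     Q X rest [::] t) ->
  wp (tables ps pr) Q (fun=> 0) (k :: rest) [::] 0.
Proof.
move=> decs decr HQ; rewrite /tables -lock.
set tab := table sigma rho in HQ *; set st := total_steps taus taur in HQ *.
eapply wp_Seq; eapply wp_Read; rewrite [behead _]/= [head _ _]/=.
do 3!step idtac.
do 6!step ltac:(rewrite ?addnn ?addn2 ?addn0 ?addn1 1?[_ + 100]addnC).
set X := upd _ _ _.
have I0 : tables_inv tab k 0 0 X.
  split; rewrite /X; try by [reads | by []].
  by rewrite /fresh; reads => a a_ge; rewrite !updN //; lia.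
have Xn1 : X rn1 = k.+1 by rewrite /X; reads.
clearbody X; set C := cost_unit ps pr in HQ *.
eapply (wp_for (I := fun j X' inp out t =>
  [/\ tables_inv tab k j.*2 (st j) X', X' rn1 = k.+1, inp = rest, out = [::] &
      t <= st j * C + j * 15 + 13])).
- exact: inv1 I0.
- by [].
- move=> v; split; [ | by reads | by [] | by [] | by lia].
  have aX : agree [:: rv; dif] (upd (upd X rv 0) dif v) X by agrees.
  exact: tables_inv_agree I0 aX _.
- rewrite Xn1 => j Y inp out t1 lt_j [IY Yn1 -> -> le1] Yj _ _.
  have lt0 : j.*2 < k.*2.+2 by lia.
  have lt1 : j.*2.+1 < k.*2.+2 by lia.
  eapply wp_Seq; eapply (wp_table_entry decr IY lt0 Yj).
    by rewrite /tab /table odd_double doubleK.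
  move=> Z t2 IZ Zj Zn1 le2.
  eapply (wp_table_entry decs IZ lt1 Zj).
    by rewrite /tab /table /= odd_double uphalf_double.
  move=> U t3 IU Uj Un1 le3.
  split; [exact: Uj | by rewrite Un1 Zn1 | exact: inv1 IU | move=> v].
  split; [ | by reads; rewrite Un1 Zn1 | by [] | by [] | ].
    have aU : agree [:: rv; dif] (upd (upd U rv j.+1) dif v) U by agrees.
    rewrite doubleS /st total_stepsS addnA; exact: tables_inv_agree IU aU _.
  rewrite /st total_stepsS -/st.
  have : taur j * (5 * size pr + 25) <= taur j * C.
    by rewrite leq_mul2l /C /cost_unit; apply/orP; right; lia.
  have : taus j * (5 * size ps + 25) <= taus j * C.
    by rewrite leq_mul2l /C /cost_unit; apply/orP; right; lia.
  rewrite !mulnDl; lia.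
- rewrite Xn1 => Y inp out t1 [IY _ -> -> le1]; apply: HQ; last lia.
  by rewrite -doubleS.
Qed.

(** * The computable time bound and the reduction *)

Lemma wp_doubling (Q : assertion) X inp out t :
  X one = 1 ->
  (forall X' t', X' rg = 2 ^ X rq -> Q X' inp out t') ->
  wp (Const rg 1;; For ri rq (Add rg rg rg)) Q X inp out t.
Proof.
move=> X1 HQ; step idtac.
set W := upd _ _ _.
eapply (wp_for_frame (V := [:: rg; ri; dif]) (acc := [:: (rg, expn 2)])
  (F := fun=> [::]) (B := 1)).
- by rewrite /W; reads.
- by [].
- by split; rewrite /W.
- move=> j Y out1 t1 _ aY [gY _] Yj; step ltac:(rewrite gY).
  split; [by agrees | by reads | | by [] | by rewrite cats0; split=> //; lia].
  by rewrite /=; reads; rewrite expnS; split=> //; lia.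
- move=> Y t1 aY [gY _] _; rewrite (_ : flatten _ = [::]) ?cats0.
    by apply: HQ; rewrite gY /W; reads.
  by elim: (iota _ _).
Qed.

(** Of the work of [tables] only the step count [rst] is used. A power of two absorbs every
    polynomial in [k] and [rst], and is computed by doubling, however long that takes. *)
Definition bound_prog (ps pr : program) (b : nat) : cmd := locked (
  tables ps pr;; Add rB rk rst;; Const rA 34;; Const rq b;;
  For ri rA (Add rq rq rB);;
  (Const rg 1;; For ri rq (Add rg rg rg));; Write rg).

Definition time_bound (taus taur : nat -> nat) (b k : nat) : nat :=
  2 ^ (b + 34 * (k + total_steps taus taur k.+1)).

Lemma time_bound_computable sigma rho ps pr taus taur b :
  decides_in sigma ps taus -> decides_in rho pr taur ->
  computable (time_bound taus taur b).
Proof.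
move=> decs decr; exists (compile (bound_prog ps pr b) 0) => k.
set y := [:: time_bound _ _ _ _].
suff : wp (bound_prog ps pr b) (fun _ _ out _ => out = y)
    (fun=> 0) [:: k] [::] 0.
  by case/wp_outputs => out [T [-> HT]]; exists T.
rewrite /bound_prog -lock; eapply wp_Seq; eapply (wp_tables decs decr).
move=> X t I _; set st := total_steps _ _ _ in I.
step ltac:(rewrite (inv_k I) (inv_st I)).
do 2!step idtac.
set W := upd _ _ _.
have W1 : W one = 1 by rewrite /W; reads; rewrite (inv1 I).
eapply wp_Seq; eapply (wp_for_frame (V := [:: rq; ri; dif])
  (acc := [:: (rq, fun j => b + j * (k + st))]) (F := fun=> [::]) (B := 1)) => //.
- by split=> //=; rewrite /W; reads; rewrite addn0.
- move=> j Y out1 t1 _ aY [qY _] Yj; step ltac:(rewrite qY /W; reads).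
  split; [by agrees | by reads | | by [] | by rewrite cats0; split=> //; lia].
  by rewrite /=; reads; split=> //; lia.
move=> Y t1 aY [qY _] _; rewrite (_ : flatten _ = [::]); last by elim: (iota _ _).
eapply wp_Seq; eapply wp_doubling; first by reads.
move=> Z t2 gZ; rewrite cats0; step ltac:(rewrite gZ (qY : Y rq = _)).
by rewrite /W; reads.
Qed.

Lemma computable_id : computable id.
Proof.
exists (compile (Read rA;; Write rA) 0) => n.
suff : wp (Read rA;; Write rA) (fun _ _ out _ => out = [:: n])
    (fun=> 0) [:: n] [::] 0.
  by case/wp_outputs => out [T [-> HT]]; exists T.
by eapply wp_Seq; eapply wp_Read; step idtac.
Qed.

(* Here [L] exceeds the length of the input, and [z = 100 * 4 ^ k * L] bounds the
   ranges of the loops of [load] and [generate], which cost [z ^ 2 + z ^ 16];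
   this is where 34 and 17 come from, as [100 ^ 17 < 2 ^ 119].  The other terms
   on the left are the cost of [tables]. *)
Lemma cost_le C k st L : 0 < L ->
  st * C + 15 * k + 28 + (100 * 4 ^ k * L) ^ 2 + (100 * 4 ^ k * L) ^ 16 <=
  2 ^ (C + 120 + 34 * (k + st)) * L ^ 17.
Proof.
move=> L_gt; set z := 100 * 4 ^ k * L.
have pos a : 0 < 2 ^ a by rewrite expn_gt0.
have lt2 a : a < 2 ^ a by rewrite ltn_expl.
have z_ge : 100 <= z by rewrite /z -mulnA leq_pmulr // muln_gt0 L_gt expn_gt0.
have le16 : z ^ 2 + z ^ 16 <= z ^ 17.
  rewrite [z ^ 17]expnS; have : z ^ 2 <= z ^ 16 by rewrite leq_pexp2l //; lia.
  have : 2 * z ^ 16 <= z * z ^ 16 by rewrite leq_mul2r; apply/orP; right; lia.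
  lia.
set e := C + 119 + 34 * (k + st).
have le17 : z ^ 17 <= 2 ^ e * L ^ 17.
  rewrite /z expnMn leq_mul2r; apply/orP; right.
  apply: (@leq_trans (2 ^ ((7 + 2 * k) * 17))); last first.
    by rewrite leq_pexp2l // /e; lia.
  rewrite (expnM 2 _ 17) leq_exp2r // expnD (expnM 2 2 k) leq_mul2r.
  by apply/orP; right.
have stC : st * C + 15 * k + 28 <= 2 ^ e.
  apply: (@leq_trans (2 ^ (C + st + k + 7))); last first.
    by rewrite leq_pexp2l // /e; lia.
  have : st * C <= 2 ^ (C + st) by rewrite expnD mulnC; apply: leq_mul; apply: ltnW.
  rewrite (expnD _ _ 7) (expnD _ (C + st)); have := lt2 k; have := pos (C + st).
  move: (2 ^ (C + st)) (2 ^ k) => a b a_gt b_gt le_a.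
  have : a * 1 <= a * b by rewrite leq_mul2l; lia.
  have : 1 * b <= a * b by rewrite leq_mul2r; lia.
  rewrite (_ : 2 ^ 7 = 128) //; lia.
have -> : 2 ^ (C + 120 + 34 * (k + st)) = 2 * 2 ^ e.
  by rewrite -expnS; congr (2 ^ _); rewrite /e; lia.
have : 1 * 2 ^ e <= L ^ 17 * 2 ^ e by rewrite leq_mul2r expn_gt0 L_gt orbT.
rewrite -mulnA (mulnC (2 ^ e)) in le17 *; lia.
Qed.

Definition reduction (ps pr : program) : cmd :=
  tables ps pr;; load;; generate.

(** The last three conditions are what correctness uses about [n] and [M]: the entries of the word,
    and [n] as the least number whose square is at least the length. *)
Lemma reduction_outputs sigma rho ps pr taus taur w k :
  decides_in sigma ps taus -> decides_in rho pr taur ->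
  exists n M T, [/\
    outputs_in (compile (reduction ps pr) 0) (instance_tape w k)
      (instance_tape (circuit_code (cnf_circuit (k * n.+1)
         (red_clauses k n (size w) M (table sigma rho)))) k) T,
    T <= time_bound taus taur (cost_unit ps pr + 120) k * (size w).+1 ^ 17,
    forall i, i < size w -> M i = (nth false w i).+1,
    size w <= n * n & forall m, m < n -> m * m < size w].
Proof.
move=> decs decr; set tab := table sigma rho.
suff : wp (reduction ps pr) (fun _ _ out t => exists n M, [/\
    out = instance_tape (circuit_code (cnf_circuit (k * n.+1)
         (red_clauses k n (size w) M tab))) k,
    t <= time_bound taus taur (cost_unit ps pr + 120) k * (size w).+1 ^ 17,
    forall i, i < size w -> M i = (nth false w i).+1,
    size w <= n * n & forall m, m < n -> m * m < size w])
    (fun=> 0) (instance_tape w k) [::] 0.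
  case/wp_outputs => out [T [[n [M [-> ? ? ? ?]]] HT]].
  by exists n, M, T.
(* [4 ^ k] bounds both [k] and [3 ^ k], and is a power of two like the time bound. *)
set z := 100 * 4 ^ k * (size w).+1.
have k4 : k < 4 ^ k by rewrite ltn_expl.
have k3 : 3 ^ k <= 4 ^ k by case: (k) => // m; rewrite leq_exp2r.
have z_ge : 100 <= z by rewrite /z -mulnA leq_pmulr // muln_gt0 expn_gt0.
have z_gew : 100 * (size w).+1 <= z by rewrite /z mulnAC leq_pmulr // expn_gt0.
have z_gek : 100 * 4 ^ k <= z by rewrite /z leq_pmulr.
eapply wp_Seq; eapply (wp_tables decs decr) => X t I le1.
eapply wp_Seq; eapply (wp_load (z := z) (k := k) (tab := tab) z_ge).
- lia.
- lia.
- exact: inv1 I.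
- exact: inv2 I.
- exact: inv0 I.
- exact: inv_k I.
- by rewrite (inv_tab I).
- by rewrite (inv_tab I) (inv_mat I).
- by move=> a lt_a; rewrite (inv_tab I) (inv_entries I).
move=> n M Y t2 eY YN Ynn YNI HM n_ge n_min le2.
have n_le : n <= size w.
  case: leqP => // /n_min; rewrite ltnNge.
  by case: (size w) => // m; rewrite leq_pmulr.
have kz : k <= z by lia.
have nz : n < z by lia.
have cz : 3 ^ k <= z by lia.
eapply (wp_generate z_ge kz nz cz eY YN Ynn YNI) => X' t3 le3.
exists n, M; split=> //.
have := @cost_le (cost_unit ps pr) k (total_steps taus taur k.+1) (size w).+1 isT.
rewrite -/z => le_z; apply: leq_trans le_z; lia.
Qed.

(** * Correctness of the reduction *)

(** Clauses read inputs only, so the value of a clause does not depend on the values [s] of the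
    gates before it. *)
Lemma node_values_or (T : Type) (F : seq T -> gate -> T) G inp
    (cls : seq (seq nat)) :
  (forall c s, c \in cls -> F (inp ++ s) (Or c) = G c) ->
  node_values F inp [seq Or c | c <- cls] = inp ++ [seq G c | c <- cls].
Proof.
rewrite /node_values => FG.
have gen s : (forall c, c \in cls -> forall s, F (inp ++ s) (Or c) = G c) ->
    foldl (fun vs g => rcons vs (F vs g)) (inp ++ s) [seq Or c | c <- cls] =
    (inp ++ s) ++ [seq G c | c <- cls].
  elim: cls s {FG} => [|c cls IH] s FG /=; first by rewrite cats0.
  rewrite FG ?mem_head // rcons_cat IH -?catA ?cat_rcons // => c' c'cls.
  by apply: FG; rewrite in_cons c'cls orbT.
by have := gen [::] (fun c ccls s => FG c s ccls); rewrite cats0.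
Qed.

Lemma cnf_circuit_wf ni (cls : seq (seq nat)) :
  (forall c, c \in cls -> all (gtn ni) c) ->
  wf_circuit (cnf_circuit ni cls).
Proof.
move=> lits_lt.
apply/andP; split; first by rewrite /= size_rcons size_map ltn_add2l ltnSn.
apply/allP => j; rewrite mem_iota size_rcons size_map add0n ltnS leq0n leq_eqVlt /=.
rewrite nth_rcons size_map.
case/orP => [/eqP->|lt_j]; last first.
  rewrite lt_j (nth_map [::]) //=; apply/allP => i.
  move/(allP (lits_lt _ (mem_nth [::] lt_j))) => /= lt_i.
  exact: ltn_addr.
rewrite ltnn eqxx /=; apply/allP => i; rewrite mem_iota; lia.
Qed.

Lemma cnf_circuit_eval ni (cls : seq (seq nat)) (a : seq bool) :
  (forall c, c \in cls -> all (gtn ni) c) -> size a = ni ->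
  circuit_eval (cnf_circuit ni cls) a = all (has (nth false a)) cls.
Proof.
move=> lits_lt size_a; rewrite /circuit_eval /= /node_values -cats1 foldl_cat /=.
rewrite -/(node_values _ _ _) (node_values_or (G := has (nth false a))); last first.
  move=> c s ccls /=; apply: eq_in_has => i ic; rewrite nth_cat size_a.
  by have /= -> := allP (lits_lt _ ccls) i ic.
rewrite nth_rcons size_cat size_map size_a ltnn eqxx.
rewrite -[X in iota X]addn0 iotaDl all_map -(mkseq_nth [::] cls) /mkseq all_map.
rewrite size_map size_iota; apply: eq_in_all => j.
rewrite mem_iota add0n => /= lt_j; rewrite nth_cat size_a ltnNge leq_addr addKn.
by rewrite /= (nth_map [::]) ?size_mkseq // nth_mkseq.
Qed.

(** A path meets at most one clause and the output gate; this bounds depth and weft alike. *)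
Lemma cnf_circuit_max_path ni (cls : seq (seq nat)) (wt : gate -> nat) :
  (forall c, c \in cls -> all (gtn ni) c) -> (forall g, wt g <= 1) ->
  max_path wt (cnf_circuit ni cls) <= 2.
Proof.
move=> lits_lt wt1; rewrite /max_path /= /node_values -cats1 foldl_cat /=.
rewrite -/(node_values _ _ _) (node_values_or (G := fun c => wt (Or c))).
  rewrite nth_rcons size_cat size_map size_nseq ltnn eqxx.
  apply: (@leq_add _ _ 1 1) => //; elim: (iota _ _) => [|i s IH]; rewrite ?big_nil //.
  rewrite big_cons geq_max IH andbT nth_cat size_nseq nth_nseq.
  case: ltnP => // _; case: (ltnP (i - ni) (size cls)) => lt_i.
    by rewrite (nth_map [::]).
  by rewrite nth_default // size_map.
move=> c s ccls /=; rewrite -[RHS]addn0; congr addn.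
apply: big1_seq => i /=  ic; have lt_i := allP (lits_lt _ ccls) _ ic.
by rewrite nth_cat size_nseq ifT // nth_nseq if_same.
Qed.

(** By injectivity of [circuit_code], the circuit that the word encodes can only be this one. *)
Lemma weighted_cnf_circuit_sat ni (cls : seq (seq nat)) k :
  (forall c, c \in cls -> all (gtn ni) c) ->
  weighted_circuit_sat 2 2 (circuit_code (cnf_circuit ni cls)) k <->
  exists a : ni.-tuple bool, count id a = k /\ all (has (nth false a)) cls.
Proof.
move=> lits_lt; split.
  case=> C [/circuit_code_inj <- _ _ _ [a [cnt ev]]]; exists a; split=> //.
  by rewrite -(cnf_circuit_eval lits_lt) ?size_tuple.
case=> a [cnt ev]; exists (cnf_circuit ni cls); split=> //.
- exact: cnf_circuit_wf.
- by apply: cnf_circuit_max_path => // g; case: (large g).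
- exact: cnf_circuit_max_path.
- by exists a; split=> //; rewrite (cnf_circuit_eval lits_lt) ?size_tuple.
Qed.

(** * Satisfying assignments as lists of chosen slots *)

Lemma mem_gather (T : eqType) (F : nat -> seq T) j x :
  reflect (exists2 i, i < j & x \in F i) (x \in gather F j).
Proof.
apply: (iffP flatten_mapP) => -[i]; first by rewrite mem_iota => *; exists i.
by move=> lt_i xF; exists i; rewrite ?mem_iota.
Qed.

(** Every sequence of types is a pattern, so the clauses of the bad patterns rule out every bad
    sequence. *)
Lemma exists_digits (f : nat -> nat) k : (forall i, f i < 3) ->
  exists2 c, c < 3 ^ k & forall i, i < k -> digit c i = f i.
Proof.
elim: k f => [|k IH] f f3; first by exists 0.
have [c lt_c dc] := IH (f \o succn) (fun i => f3 i.+1).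
exists (f 0 + 3 * c); first by have := f3 0; rewrite expnS; lia.
case=> [_|i /dc]; first by rewrite /digit divn1 addnC mulnC modnMDl modn_small.
rewrite /digit expnS divnMA addnC mulnC divnMDl // (divn_small (f3 0)) addn0.
exact.
Qed.

(* [bad_at k n M tab L v] says that the clauses of [v] exclude the list [L] of
   the [k] selected slots. *)
Definition bad_at (n : nat) (M tab : nat -> nat) (L : seq nat) (v : nat) : bool :=
  let nb := count (fun u => typ n M v u == 1) L in
  let sf := count (fun u => typ n M v u == 2) L in
  tab (nb.*2 + sf) <= sf - 1.

(** The link between assignments and dominating sets: entry [i] is the [u] for which [x_(i,u)] is
    true, with [n] for an empty slot. *)
Definition selection (k n : nat) (M tab : nat -> nat) (L : seq nat) : Prop :=
  [/\ size L = k, all (leq^~ n) L & forall v, v < n -> ~~ bad_at n M tab L v].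

Lemma count_digitE n M v L c k : size L = k ->
  (forall i, i < k -> digit c i = typ n M v (nth 0 L i)) ->
  forall g, count_digit g c k = count (fun u => typ n M v u == g) L.
Proof.
move=> sL dL g; rewrite /count_digit -[in RHS](mkseq_nth 0 L) /mkseq count_map sL.
by apply: eq_in_count => i; rewrite mem_iota /= => /dL ->.
Qed.

Lemma row_litsP n M v g i x :
  reflect (exists u, [/\ u <= n, typ n M v u != g & x = i * n.+1 + u])
    (x \in row_lits n M v g i).
Proof.
apply: (iffP (mem_gather _ _ _)) => [[u lt_u]|[u [le_u tg ->]]].
  by case: eqP => // /eqP tg; rewrite inE => /eqP ->; exists u.
by exists u; rewrite ?ltnS // (negPf tg) mem_head.
Qed.

Lemma sum_blocks (F : nat -> nat) k n :
  \sum_(0 <= j < k * n) F j = \sum_(0 <= i < k) \sum_(0 <= u < n) F (i * n + u).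
Proof.
elim: k => [|k IH]; first by rewrite !big_geq.
rewrite big_nat_recr //= -IH mulSn addnC (big_cat_nat (n := k * n)) ?leq_addr //=.
congr (_ + _); rewrite -{1}[k * n]add0n big_addn addKn.
by apply: eq_bigr => u _; rewrite addnC.
Qed.

Lemma count_sum_nth (a : seq bool) :
  count id a = \sum_(0 <= j < size a) nth false a j.
Proof.
rewrite -sum1_count (big_nth false) big_mkcond.
by apply: eq_bigr => j _; case: (nth _ _ _).
Qed.

(** Each of the [k] blocks contributes at least 1 to a total of [k], which leaves no room for a
    second true variable in any block. *)
Lemma one_per_block k n (a : seq bool) :
  let A i u := nth false a (i * n.+1 + u) in
  size a = k * n.+1 -> count id a = k ->
  (forall i, i < k -> exists2 u, u <= n & A i u) ->
  forall i u u', i < k -> u <= n -> u' <= n -> A i u -> A i u' -> u = u'.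
Proof.
move=> A size_a cnt ex i u u' lt_i le_u le_u' Au Au'.
pose s i := \sum_(0 <= u < n.+1) A i u.
have sum_s : \sum_(0 <= i < k) s i = \sum_(0 <= i < k) 1.
  have := sum_blocks (fun j => nat_of_bool (nth false a j)) k n.+1.
  rewrite -size_a -count_sum_nth cnt => <-.
  by rewrite sum_nat_const_nat subn0 muln1.
have s_ge j : j < k -> 1 <= s j.
  case/ex => w le_w Aw.
  rewrite /s big_mkord (bigD1 (Ordinal (le_w : w < n.+1))) //=.
  by rewrite Aw.
have s1 : s i = 1.
  have rest : \sum_(j < k | j != Ordinal lt_i) 1 <=
      \sum_(j < k | j != Ordinal lt_i) s j by apply: leq_sum => j _; exact: s_ge.
  rewrite sum1_card cardC1 card_ord in rest.
  move: sum_s (s_ge i lt_i) rest.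
  rewrite sum_nat_const_nat big_mkord (bigD1 (Ordinal lt_i)) //=.
  by move: (s i) (\sum_(_ < k | _) _) => x y; lia.
apply/eqP; apply: contra_eqT s1 => neq_u; rewrite /s big_mkord.
rewrite (bigD1 (Ordinal (le_u : u < n.+1))) //=.
rewrite (bigD1 (Ordinal (le_u' : u' < n.+1))) /= ?Au ?Au' //.
by rewrite -val_eqE /= eq_sym.
Qed.

(** If the types of the selected slots relative to [v] formed a bad pattern [c], its clause would
    make true some [x_(i,u)] with [u] of a type other than [c_i]; but [u] is the slot selected by
    [i], whose type is [c_i]. *)
Lemma selection_of_assignment k n M tab (a : seq bool) :
  (forall v u, v < n -> typ n M v u < 3) ->
  size a = k * n.+1 -> count id a = k ->
  all (has (nth false a)) (gather (fun_cl n) k) ->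
  (forall v, v < n ->
     all (has (nth false a)) (gather (pat_cl k n M tab v) (3 ^ k))) ->
  exists L, selection k n M tab L.
Proof.
move=> typ3 size_a cnt /allP a_fun a_pat.
pose A i u := nth false a (i * n.+1 + u).
have ex i : i < k -> exists2 u, u <= n & A i u.
  move=> lt_i; have /a_fun/hasP[x] : iota (i * n.+1) n.+1 \in gather (fun_cl n) k.
    by apply/mem_gather; exists i; rewrite ?mem_head.
  rewrite mem_iota => /andP[x_ge x_lt] ax; exists (x - i * n.+1); first by lia.
  by rewrite /A subnKC.
have uniqA := one_per_block size_a cnt ex.
pose d i := find (A i) (iota 0 n.+1).
have dP i : i < k -> d i <= n /\ A i (d i).
  case/ex => u le_u Au; have hasA : has (A i) (iota 0 n.+1).
    by apply/hasP; exists u; rewrite ?mem_iota.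
  have lt_d : d i < n.+1 by rewrite -[n.+1](size_iota 0) -has_find.
  by split=> //; have := nth_find 0 hasA; rewrite nth_iota.
exists (mkseq d k); split; first by rewrite size_mkseq.
  by apply/allP => x /mapP[i]; rewrite mem_iota => /andP[_ /dP[le_d _]] ->.
move=> v lt_v; apply/negP => bad.
have [c lt_c dc] := @exists_digits (fun i => typ n M v (nth 0 (mkseq d k) i)) k
  (fun i => typ3 v _ lt_v).
have cE := count_digitE (size_mkseq d k) dc.
have /(allP (a_pat v lt_v))/hasP[x /mem_gather[i lt_i]] :
    pat_clause k n M v c \in gather (pat_cl k n M tab v) (3 ^ k).
  apply/mem_gather; exists c; rewrite // /pat_cl.
  by move: bad; rewrite /bad_at -!cE => ->; rewrite mem_head.
case/row_litsP => u [le_u tg ->] Au; have [le_d Ad] := dP i lt_i.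
by move: tg; rewrite dc // nth_mkseq // (uniqA _ _ _ lt_i le_d le_u Ad Au) eqxx.
Qed.

(** The types of a selection differ from any bad pattern at some place [i], and the variable of its
    [i]-th entry then satisfies the clause. *)
Lemma assignment_of_selection k n M tab L : selection k n M tab L ->
  exists a : (k * n.+1).-tuple bool, [/\ count id a = k,
    all (has (nth false a)) (gather (fun_cl n) k) &
    forall v, v < n ->
      all (has (nth false a)) (gather (pat_cl k n M tab v) (3 ^ k))].
Proof.
case=> sL /allP Ln nbad; pose d := nth 0 L.
have d_le i : i < k -> d i <= n by move=> lt_i; apply: Ln; rewrite mem_nth ?sL.
pose a := mkseq (fun j => j %% n.+1 == d (j %/ n.+1)) (k * n.+1).
have size_a : size a == k * n.+1 by rewrite size_mkseq.
have aE i u : i < k -> u <= n -> nth false a (i * n.+1 + u) = (u == d i).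
  move=> lt_i le_u; rewrite nth_mkseq; last first.
    apply: (@leq_trans (i.+1 * n.+1)); first by rewrite mulSn addnC ltn_add2r.
    by rewrite leq_mul2r lt_i orbT.
  by rewrite modnMDl divnMDl // modn_small ?ltnS // divn_small ?ltnS // addn0.
exists (Tuple size_a); split.
- rewrite /= count_sum_nth (eqP size_a) (sum_blocks (fun j => nth false a j)).
  rewrite [RHS](_ : k = \sum_(0 <= i < k) 1); last first.
    by rewrite sum_nat_const_nat subn0 muln1.
  apply: eq_big_nat => i /= lt_i.
  rewrite big_mkord (bigD1 (Ordinal (d_le i lt_i : d i < n.+1))) //=.
  rewrite aE ?d_le // eqxx.
  rewrite big1 ?addn0 // => u; rewrite -val_eqE /= => ne_u.
  by rewrite aE // ?(negPf ne_u) // -ltnS.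
- apply/allP => c /mem_gather[i lt_i]; rewrite inE => /eqP ->.
  apply/hasP; exists (i * n.+1 + d i); last by rewrite aE ?d_le.
  by rewrite mem_iota leq_addr ltn_add2l ltnS d_le.
- move=> v lt_v; apply/allP => cl /mem_gather[c lt_c].
  rewrite /pat_cl; case: leqP => //= bad; rewrite inE => /eqP ->.
  have := nbad v lt_v; rewrite /bad_at.
  have [|ndc] := boolP [forall i : 'I_k, digit c i == typ n M v (d i)].
    move/forallP => dc; have cE := @count_digitE n M v L c k sL
      (fun i lt_i => eqP (dc (Ordinal lt_i))).
    by rewrite -!cE bad.
  move=> _; move: ndc; rewrite negb_forall => /existsP[i ni].
  apply/hasP; exists (i * n.+1 + d i); last by rewrite aE ?d_le.
  apply/mem_gather; exists i => //; apply/row_litsP; exists (d i).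
  by rewrite d_le // eq_sym.
Qed.

(** * Lists of chosen slots as dominating sets *)

(** Entries are grouped by vertex, with multiplicity. The sum omits the mark [n] of empty slots,
    which therefore must not satisfy [P]. *)
Lemma count_sum_mem n L (P : pred nat) : all (leq^~ n) L -> ~~ P n ->
  count P L = \sum_(u < n | P u) count_mem (u : nat) L.
Proof.
move=> + nPn; elim: L => [|x L IH] /= => [_|/andP[le_x /IH->]].
  by rewrite big1.
rewrite big_split /=; congr (_ + _); move: le_x; rewrite leq_eqVlt.
case/predU1P => [->|lt_x].
  rewrite (negPf nPn) big1 // => u _; case: eqP => // eq_u.
  by have := ltn_ord u; rewrite -eq_u ltnn.
rewrite big_mkcond (bigD1 (Ordinal lt_x)) //= eqxx big1 ?addn0 => [|u].
  by case: (P x).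
by rewrite -val_eqE /= eq_sym => /negPf->; case: ifP.
Qed.

Definition adjacency n (e : rel 'I_n) (M : nat -> nat) : Prop :=
  forall u v : 'I_n, M (v * n + u) = (e v u).+1.

Lemma typE n (e : rel 'I_n) M (u v : 'I_n) : irreflexive e -> adjacency e M ->
  typ n M v u = if u == v then 2 else e v u.
Proof.
move=> irr adj; rewrite /typ ltn_ord adj subn1 /= -val_eqE /=.
by case: eqP => [/val_inj->|]; rewrite ?irr ?addn0.
Qed.

Lemma typ_null n M v : typ n M v n = 0.
Proof. by rewrite /typ ltnn. Qed.

(** Type 2 occurs [v \in D] times and type 1 once for every neighbour of [v] in [D]. Hence [sf - 1]
    is 0, and badness says that the table entry for [sigma] or [rho] is 0. *)
Lemma bad_at_dominating sigma rho n (e : rel 'I_n) M L (D : {set 'I_n})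
    (v : 'I_n) :
  irreflexive e -> adjacency e M -> all (leq^~ n) L ->
  (forall u : 'I_n, count_mem (u : nat) L = (u \in D)) ->
  bad_at n M (table sigma rho) L v =
  (#|nbhd e v :&: D| \notin (if v \in D then sigma else rho)).
Proof.
move=> irr adj Ln cD; have tE u w := @typE n e M u w irr adj; rewrite /bad_at.
rewrite !(count_sum_mem Ln) ?typ_null //.
have -> : \sum_(u < n | typ n M v u == 2) count_mem (u : nat) L = (v \in D).
  rewrite (bigD1 v) /= ?tE ?eqxx // cD big1 ?addn0 // => u.
  by rewrite tE; case: (u == v); rewrite ?andbF //; case: (e v u).
have -> : \sum_(u < n | typ n M v u == 1) count_mem (u : nat) L =
    #|nbhd e v :&: D|.
  rewrite -sum1_card big_mkcond [RHS]big_mkcond; apply: eq_bigr => u _.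
  rewrite cD !inE tE; case: (u =P v) => [->|_]; rewrite ?irr //.
  by case: (e v u); case: (u \in D).
rewrite /table; case: (v \in D); rewrite ?addn1 ?addn0 /= odd_double.
  by rewrite uphalf_double; case: (_ \in sigma).
by rewrite doubleK; case: (_ \in rho).
Qed.

Lemma selection_dominating sigma rho n (e : rel 'I_n) M k :
  irreflexive e -> adjacency e M ->
  (exists D : {set 'I_n}, sigma_rho_dominating sigma rho e D /\ #|D| <= k) <->
  exists L, selection k n M (table sigma rho) L.
Proof.
move=> irr adj; have tE u w := @typE n e M u w irr adj; split.
- case=> D [[Dsig Drho] leD].
  pose L := [seq val u | u <- enum D] ++ nseq (k - #|D|) n.
  have cD (u : 'I_n) : count_mem (u : nat) L = (u \in D).
    rewrite count_cat count_nseq /= (gtn_eqF (ltn_ord u)) mul0n addn0 count_map.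
    rewrite -mem_enum -(count_uniq_mem u (enum_uniq D)).
    by apply: eq_count => w /=; rewrite val_eqE.
  have Ln : all (leq^~ n) L.
    rewrite all_cat all_nseq leqnn orbT andbT; apply/allP => x /mapP[u _ ->].
    exact: ltnW (ltn_ord u).
  exists L; split=> //; first by rewrite size_cat size_map -cardE size_nseq subnKC.
  move=> v lt_v; rewrite -[v]/(val (Ordinal lt_v)).
  rewrite (bad_at_dominating sigma rho _ irr adj Ln cD) negbK.
  by case: ifPn => [/Dsig|/Drho].
- case=> L [sL Ln nbad]; pose D := [set u : 'I_n | val u \in L].
  have cD (u : 'I_n) : count_mem (u : nat) L = (u \in D).
    have := nbad u (ltn_ord u); rewrite /bad_at -ltnNge inE -has_pred1 has_count.
    have -> : count (fun w => typ n M u w == 2) L = count_mem (u : nat) L.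
      rewrite !(count_sum_mem Ln) ?typ_null ?(gtn_eqF (ltn_ord u)) //; last first.
        by rewrite /= (gtn_eqF (ltn_ord u)).
      apply: eq_bigl => w; rewrite tE -val_eqE /=.
      by case: (nat_of_ord w == u) => //; case: (e u w).
    (* Table entries are at most 1, so two occurrences of a vertex make the list bad at this vertex,
       whatever the table says. *)
    rewrite /table; case: odd; case: (_ \in _); case: (count_mem _ _) => [|[|m]] //=.
  exists D; split; last first.
    rewrite -sL -sum1_card big_mkcond /=.
    rewrite (eq_bigr (fun u : 'I_n => count_mem (u : nat) L)).
      apply: leq_trans (count_size (gtn n) L).
      rewrite (count_sum_mem Ln) /= ?ltnn // [leqRHS](eq_bigl xpredT) // => u.
      by rewrite ltn_ord.
    by move=> u _; rewrite cD; case: (u \in D).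
  have dom v : #|nbhd e v :&: D| \in (if v \in D then sigma else rho).
    have := nbad v (ltn_ord v).
    by rewrite (bad_at_dominating sigma rho _ irr adj Ln cD) negbK.
  by split=> v vD; have := dom v; [rewrite vD | rewrite (negPf vD)].
Qed.

(** * Words as adjacency matrices, and the equivalence *)

Lemma nth_allpairs (S T R : Type) (f : S -> T -> R) x0 y0 z0 s t i j :
  i < size s -> j < size t ->
  nth z0 [seq f x y | x <- s, y <- t] (i * size t + j) =
  f (nth x0 s i) (nth y0 t j).
Proof.
elim: s i => // x s IH [|i] lt_i lt_j; rewrite allpairs_cons nth_cat size_map.
  by rewrite lt_j (nth_map y0).
rewrite ifN; last by rewrite -leqNgt mulSn -addnA leq_addr.
by rewrite mulSn -addnA addKn IH.
Qed.

Lemma nth_graph_code n (e : rel 'I_n) (u v : 'I_n) :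
  nth false (graph_code e) (u * n + v) = e u v.
Proof.
have := @nth_allpairs _ _ _ e u v false (enum 'I_n) (enum 'I_n) u v.
by rewrite size_enum_ord !nth_ord_enum /graph_code => ->.
Qed.

Lemma graph_code_of_matrix n (w : seq bool) : size w = n * n ->
  w = graph_code (fun u v : 'I_n => nth false w (u * n + v)).
Proof.
move=> size_w; apply: (@eq_from_nth _ false); first by rewrite size_graph_code.
rewrite size_w => i lt_i; have n_gt : 0 < n by case: n lt_i {size_w}.
have ltq : i %/ n < n by rewrite ltn_divLR.
have ltr : i %% n < n by rewrite ltn_mod.
rewrite [i in RHS](divn_eq i n).
rewrite (nth_graph_code _ (Ordinal ltq) (Ordinal ltr)) /=.
by rewrite -divn_eq.
Qed.

Lemma red_clauses_lt k n N M tab c : c \in red_clauses k n N M tab ->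
  all (gtn (k * n.+1)) c.
Proof.
have lt_lit i u : i < k -> u <= n -> i * n.+1 + u < k * n.+1.
  move=> lt_i le_u; apply: (@leq_trans (i.+1 * n.+1)).
    by rewrite mulSn addnC ltn_add2r.
  by rewrite leq_mul2r lt_i orbT.
rewrite /red_clauses !mem_cat => /or3P[|/mem_gather[i lt_i]|/mem_gather[v _]].
- by rewrite mem_nseq => /andP[_ /eqP->].
- rewrite inE => /eqP->; apply/allP => x; rewrite mem_iota => /andP[x_ge x_lt] /=.
  by rewrite -(subnKC x_ge) lt_lit //; lia.
rewrite mem_cat => /orP[]/mem_gather[u _]; rewrite mem_nseq => /andP[_ /eqP->] //.
apply/allP => x /mem_gather[i lt_i] /row_litsP[y [le_y _ ->]].
exact: lt_lit.
Qed.

Lemma reduction_correct sigma rho w k n M :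
  (forall i, i < size w -> M i = (nth false w i).+1) ->
  size w <= n * n -> (forall m, m < n -> m * m < size w) ->
  dominating_set_at_most sigma rho w k <->
  weighted_circuit_sat 2 2 (circuit_code (cnf_circuit (k * n.+1)
    (red_clauses k n (size w) M (table sigma rho)))) k.
Proof.
move=> wM n_ge n_min; set tab := table sigma rho.
rewrite weighted_cnf_circuit_sat; last exact: red_clauses_lt.
split.
- case=> n' [e [sym irr w_e domD]].
  have size_w : size w = n' * n' by rewrite w_e size_graph_code.
  (* The length is [n' * n'], and [n] is the least number whose square is at least the length. *)
  have n'_n : n' = n.
    apply/eqP; rewrite eqn_leq; apply/andP; split.
      by rewrite -leq_sqr -!mulnn -size_w.
    by rewrite leqNgt; apply/negP => /n_min; rewrite size_w ltnn.
  rewrite {n'}n'_n in e sym irr w_e domD size_w.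
  have adj : adjacency e M.
    move=> u v; rewrite wM ?w_e ?nth_graph_code // -w_e size_w.
    apply: (@leq_trans (v.+1 * n)); first by rewrite mulSn addnC ltn_add2r.
    by rewrite leq_mul2r ltn_ord orbT.
  have [L /assignment_of_selection[a [cnt a_fun a_pat]]] :=
    (selection_dominating sigma rho k irr adj).1 domD.
  exists a; split=> //; rewrite /red_clauses size_w subnn !all_cat a_fun /=.
  apply/allP => c /mem_gather[v lt_v]; rewrite mem_cat => /orP[|cP]; last first.
    exact: (allP (a_pat v lt_v)).
  case/mem_gather => u lt_u; rewrite /sym_cl.
  rewrite (adj (Ordinal lt_u) (Ordinal lt_v)) (adj (Ordinal lt_v) (Ordinal lt_u)).
  rewrite (sym (Ordinal lt_u)) subnn addn0 add0n.
  case: (u =P v) => [eq_uv|_]; last by case: (e _ _).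
  have -> : Ordinal lt_u = Ordinal lt_v by apply: val_inj.
  by rewrite irr.
- case=> a [cnt]; rewrite /red_clauses !all_cat => /and3P[a_sq a_fun a_v].
  have size_w : size w = n * n.
    apply/eqP; rewrite eqn_leq n_ge /=; move: a_sq.
    by rewrite -(subn_eq0 (n * n)); case: (n * n - size w) => [|m].
  (* An empty clause cannot be satisfied, so none was printed: the matrix passes every test of
     symmetry and of the diagonal. *)
  have a_sym v u : v < n -> u < n -> sym_cl n M v u = [::].
    move=> lt_v lt_u; case E: (sym_cl n M v u) => [|c cs] //.
    have c0 : [::] \in sym_cl n M v u.
      by move: E; rewrite /sym_cl; case: (0 < _) => //; rewrite mem_head.
    have /(allP a_v) // : [::] \in gather (vertex_cl k n M tab) n.
    apply/mem_gather; exists v => //; rewrite mem_cat; apply/orP; left.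
    by apply/mem_gather; exists u.
  have a_pat v : v < n ->
      all (has (nth false a)) (gather (pat_cl k n M tab v) (3 ^ k)).
    move=> lt_v; apply/allP => c cP; apply: (allP a_v).
    by apply/mem_gather; exists v; rewrite // mem_cat cP orbT.
  pose e := (fun u v : 'I_n => nth false w (u * n + v)) : rel 'I_n.
  have lt_uv (u v : 'I_n) : u * n + v < size w.
    rewrite size_w; apply: (@leq_trans (u.+1 * n)).
      by rewrite mulSn addnC ltn_add2r.
    by rewrite leq_mul2r ltn_ord orbT.
  have adj : adjacency e M by move=> u v; rewrite wM.
  have sym_irr (u v : 'I_n) : e u v = e v u /\ e u u = false.
    have := a_sym u v (ltn_ord u) (ltn_ord v).
    have := a_sym u u (ltn_ord u) (ltn_ord u).
    rewrite /sym_cl !adj eqxx.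
    by case: (e u v); case: (e v u); case: (e u u).
  have sym : symmetric e by move=> u v; case: (sym_irr u v).
  have irr : irreflexive e by move=> u; case: (sym_irr u u).
  exists n, e; split=> //; first exact: graph_code_of_matrix.
  apply/(selection_dominating sigma rho k irr adj).
  apply: (selection_of_assignment _ (size_tuple a) cnt a_fun a_pat) => v u lt_v.
  (* The type of [v] itself is the diagonal entry plus 2, which is a base 3 digit because there are
     no loops. *)
  rewrite /typ; case: (ltnP u n) => // lt_u.
  rewrite (adj (Ordinal lt_u) (Ordinal lt_v)).
  case: eqP => [eq_uv|_]; last by case: (e _ _).
  have -> : Ordinal lt_u = Ordinal lt_v by apply: val_inj.
  by rewrite irr.
Qed.

Theorem theorem2 (sigma rho : {pred nat}) :
  recursive_set sigma -> recursive_set rho ->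
  W 2 (dominating_set_at_most sigma rho).
Proof.
move=> /recursive_set_decides[ps [taus decs]].
move=> /recursive_set_decides[pr [taur decr]].
exists 2, (compile (reduction ps pr) 0).
exists (time_bound taus taur (cost_unit ps pr + 120)), id, 17.
split; [exact: time_bound_computable decs decr | exact: computable_id |].
move=> w k.
have [n [M [T [out_T T_le wM n_ge n_min]]]] := reduction_outputs w k decs decr.
exists (circuit_code (cnf_circuit (k * n.+1)
  (red_clauses k n (size w) M (table sigma rho)))), k, T.
by split=> //; exact: reduction_correct.
Qed.
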